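(* Let $p>0$. If $p$ is not an even integer, then there is full $p$-concentration with gap at $1/2$: for every $c<1$, every symmetric open set $E\subset\mathbb{T}$ containing $1/2$ and every $N>0$ there is $f\in\mathcal{P}$ with gaps larger than $N$ such that $\int_E|f|^p\ge c\int_{\mathbb{T}}|f|^p$. On the other hand, if $p=2k$ with $k\ge 1$ an integer, then $c_{2k}(1/2)=1/2$.
   Context: $\mathbb{T}=\mathbb{R}/\mathbb{Z}$ with Lebesgue measure of total mass $1$; $e(t)=e^{2\pi i t}$; $\mathbb{N}$ denotes the nonnegative integers. $\mathcal{P}$ is the set of idempotents, i.e. of functions $f(x)=\sum_{h\in H}e(hx)$ on $\mathbb{T}$ with $H\subset\mathbb{N}$ finite and nonempty. Such an $f$ has gaps larger than $N$ if consecutive elements of $H$ (in increasing order) differ by more than $N$. A set $E\subset\mathbb{T}$ is symmetric if $x\in E$ implies $-x\in E$. For $p>0$ and $a\in\mathbb{T}$, $c_p(a)$ is the supremum of all constants $c\ge 0$ such that for every symmetric open set $E\subset\mathbb{T}$ containing $a$ there is $f\in\mathcal{P}$ with $\int_E|f|^p\ge c\int_{\mathbb{T}}|f|^p$. *)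

(* Defs.v *)
(* Functions on the circle T = R/Z are 1-periodic functions on the real line,
   and subsets of T are subsets of the real line that are invariant under
   x |-> x + 1; the open subsets of T are then exactly the open invariant
   subsets.  Lebesgue measure of mass 1 on T is Lebesgue measure on the
   fundamental domain [0, 1[. *)
From HB Require Import structures.
From mathcomp Require Import all_boot all_order all_algebra.
From mathcomp Require Import finmap.
From mathcomp Require Import all_classical all_reals all_analysis.
From mathcomp Require Import complex.

Set Implicit Arguments.
Unset Strict Implicit.
Unset Printing Implicit Defensive.

Import Order.TTheory GRing.Theory Num.Theory.
Import numFieldNormedType.Exports.

Local Open Scope classical_set_scope.
Local Open Scope ring_scope.

Section CircleIdempotents.
Variable R : realType.
Implicit Types (E : set R) (H : {fset nat}) (f : R -> R[i]) (p a c t x : R).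

(* exp(2 pi i t) *)
Definition e2pi t : R[i] := Complex (cos (2 * pi * t)) (sin (2 * pi * t)).

Definition exp_sum H x : R[i] := \sum_(h <- H) e2pi (h%:R * x).

Definition gaps_larger (N : nat) H : Prop :=
  forall h h', h \in H -> h' \in H -> (h < h')%N ->
    (forall m, m \in H -> ~~ (h < m < h')%N) -> (N < h' - h)%N.

Definition idempotents : set (R -> R[i]) :=
  [set exp_sum H | H in [set H | H != fset0]].

Definition gap_idempotents (N : nat) : set (R -> R[i]) :=
  [set exp_sum H | H in [set H | H != fset0 /\ gaps_larger N H]].

Definition circle_set E : Prop := forall x, E (x + 1) <-> E x.

Definition symmetric_set E : Prop := forall x, E x -> E (- x).

Definition sym_open_nbhd a E : Prop :=
  [/\ circle_set E, open E, symmetric_set E & E a].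

(* The integral over E, a subset of T, of |f|^p. *)
Definition Lp_mass p E f : \bar R :=
  (\int[lebesgue_measure]_(x in E `&` `[0%R, 1%R[)
      (ComplexField.Normc.normc (f x) `^ p)%:E)%E.

Definition concentrates p c E f : Prop :=
  (c%:E * Lp_mass p setT f <= Lp_mass p E f)%E.

(* The supremum is taken in the extended reals, where it always exists. *)
Definition concentration_const p a : \bar R :=
  ereal_sup [set c%:E | c in [set c | 0 <= c /\
    forall E, sym_open_nbhd a E ->
      exists2 f, idempotents f & concentrates p c E f]].

End CircleIdempotents.

(* Main.v *)
(* Write |1 + e(t)|^p = 4^(p/2) (1 - s)^(p/2) with s = (1 - cos 2 pi t)/2, and
   let q > p/2 be an integer. If p/2 is not an integer, the binomial
   coefficients of (1 - s)^(p/2) have a constant sign from degree q on, so that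
   the Fourier coefficients of |1 + e(t)|^p alternate in sign from frequency q
   on. Hence the function
     G(x) = int |1 + e((q+1) y - x)|^p |1 + e(q y - x)|^p dy,
   whose nonconstant Fourier coefficients are products of one such coefficient
   at t (q+1) and one at t q, has coefficients of sign (-1)^t and is maximal at
   1/2 only. If m_1, ..., m_L grow fast, the idempotent
     prod_j (1 + e(((q+1) m_j - 1) x)) (1 + e((q m_j - 1) x))
   has large gaps and its p-th power is equidistributed to G^L, which
   concentrates at 1/2 as L grows. For p = 2k, |f|^p has nonnegative Fourier
   coefficients, so int cos(2 pi x) |f|^p >= 0: a small neighbourhood of 1/2
   carries at most about half of the mass; the idempotents with spectrum
   {0, 2, 4, ..., 2^(j+1) - 2} attain this bound in the limit. *)
Require Import Defs.
From mathcomp Require Import all_boot all_order all_algebra.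
From mathcomp Require Import finmap complex ring lra zify.
From mathcomp Require Import all_classical all_reals all_analysis.

Set Implicit Arguments.
Unset Strict Implicit.
Unset Printing Implicit Defensive.

Import Order.TTheory GRing.Theory Num.Theory.
Import numFieldNormedType.Exports.

Local Open Scope classical_set_scope.
Local Open Scope ring_scope.

(** * Means over the circle *)

Section Mean.
Context {R : realType}.
Implicit Types (f g : R -> R) (a b c x y : R).

Definition mean g : R := \int[lebesgue_measure]_(x in `[0, 1[) g x.

Lemma integrable01 g : continuous g ->
  lebesgue_measure.-integrable `[0, 1[ (EFin \o g).
Proof.
move=> cg; apply: (@integrableS _ _ _ lebesgue_measure `[0%R, 1%R]) => //.
  by apply: subset_itvl; rewrite bnd_simp.
by apply: continuous_compact_integrable; [exact: segment_compact|exact: continuous_subspaceT].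
Qed.

Lemma mean_cst c : mean (fun=> c) = c.
Proof.
rewrite /mean Rintegral_cst //= lebesgue_measure_itv /= lte_fin ltr01.
by rewrite -EFinB /= subr0 mulr1.
Qed.

Lemma meanD f g : continuous f -> continuous g ->
  mean (fun x => f x + g x) = mean f + mean g.
Proof. by move=> cf cg; apply: RintegralD => //; exact: integrable01. Qed.

Lemma meanZ c g : continuous g -> mean (fun x => c * g x) = c * mean g.
Proof. by move=> cg; apply: RintegralZl => //; exact: integrable01. Qed.

Lemma le_mean f g : continuous f -> continuous g -> (forall x, f x <= g x) ->
  mean f <= mean g.
Proof.
by move=> cf cg fg; apply: le_Rintegral => //; exact: integrable01.
Qed.

Lemma mean_ge0 g : (forall x, 0 <= g x) -> 0 <= mean g.
Proof. by move=> g0; apply: Rintegral_ge0. Qed.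

Lemma meanB f g : continuous f -> continuous g ->
  mean (fun x => f x - g x) = mean f - mean g.
Proof. by move=> cf cg; apply: RintegralB => //; exact: integrable01. Qed.

Lemma mean_dist f g c : continuous f -> continuous g ->
  (forall x, `|f x - g x| <= c) -> `|mean f - mean g| <= c.
Proof.
move=> cf cg fgc; rewrite -meanB //.
have cB : continuous (fun x => f x - g x).
  by move=> x; apply: cvgB; [exact: cf|exact: cg].
rewrite ler_norml -[in X in _ && X](mean_cst c) -[in X in X && _](mean_cst (- c)).
apply/andP; split; apply: le_mean => //; try exact: cst_continuous.
  by move=> x; have := fgc x; rewrite ler_norml => /andP[].
by move=> x; have := fgc x; rewrite ler_norml => /andP[].
Qed.

Lemma cosDn2pi (n : nat) x : cos (x + 2 * pi * n%:R) = cos x.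
Proof.
have := periodicn (@cosD2pi R) n x; congr (cos _ = _).
by rewrite -mulr_natl; ring.
Qed.

Lemma sinDn2pi (n : nat) x : sin (x + 2 * pi * n%:R) = sin x.
Proof.
have := periodicn (@sinD2pi R) n x; congr (sin _ = _).
by rewrite -mulr_natl; ring.
Qed.

Lemma sinDz2pi (n : int) x : sin (x + 2 * pi * n%:~R) = sin x.
Proof.
case: n => n; first by rewrite sinDn2pi.
by rewrite -[in RHS](subrK (2 * pi * n.+1%:R) x) sinDn2pi NegzE mulrNz mulrN.
Qed.

Lemma continuous_cos_affine a b : continuous (fun x => cos (2 * pi * (a * x + b))).
Proof.
move=> x; apply: continuous_comp; last exact: continuous_cos.
apply: cvgM; first exact: cvg_cst.
by apply: cvgD; [apply: cvgM; [exact: cvg_cst|exact: cvg_id]|exact: cvg_cst].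
Qed.

(** For [n != 0] the cosine has the antiderivative [F], which takes equal values at 0 and 1 since
    the argument of the sine moves by an integer multiple of $2\pi$. *)
Lemma mean_cos (n : int) b :
  mean (fun x => cos (2 * pi * (n%:~R * x + b))) =
  (n == 0)%:R * cos (2 * pi * b).
Proof.
have [->|n0] := eqVneq n 0.
  by under eq_fun do rewrite mul0r add0r; rewrite mean_cst mul1r.
rewrite mul0r.
set a : R := n%:~R.
have a0 : a != 0 by rewrite intr_eq0.
have pi0 : (pi : R) != 0 by rewrite gt_eqF // pi_gt0.
pose F x := (2 * pi * a)^-1 * sin (2 * pi * (a * x + b)).
have dF x : is_derive x 1 F (cos (2 * pi * (a * x + b))).
  apply: is_derive_eq.
  by rewrite /GRing.scale /=; move: (pi : R) pi0 => P pi0; field; rewrite a0 pi0.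
have cc := @continuous_cos_affine a b.
rewrite /mean /Rintegral integral_itv_bndo_bndc; last first.
  exact: (measurable_int _ (integrable01 cc)).
rewrite (@continuous_FTC2 _ _ F) //.
- rewrite -EFinB /F /=.
  have -> : 2 * pi * (a * 1 + b) = 2 * pi * (a * 0 + b) + 2 * pi * n%:~R.
    by rewrite /a; ring.
  by rewrite sinDz2pi subrr.
- exact: continuous_subspaceT.
- have cF : continuous F.
    by move=> x; apply: differentiable_continuous; apply/derivable1_diffP; exact: ex_derive.
  split.
  + by move=> x _; exact: ex_derive.
  + exact: cvg_at_right_filter (cF 0).
  + exact: cvg_at_left_filter (cF 1).
- by move=> x _; rewrite derive1E; exact: derive_val.
Qed.

End Mean.

(** * Trigonometric polynomials and their uniform closure *)

Section CosineSums.
Context {R : realType}.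

(** Finite sums of terms $c\cos(2\pi u(t))$ whose pairs [(c, u)] all satisfy [P]. Leaving [P] free
    lets one product rule track signs of coefficients, degrees, parities and integrality of
    frequencies; leaving [T] free covers one and two variables. *)
Inductive cosum T (P : R -> (T -> R) -> Prop) : (T -> R) -> Prop :=
| cosum0 : cosum P (fun=> 0)
| cosum_cons c u F : P c u -> cosum P F ->
    cosum P (fun t => c * cos (2 * pi * u t) + F t).

Lemma cosum_ext T (P : R -> (T -> R) -> Prop) F G :
  F =1 G -> cosum P F -> cosum P G.
Proof. by move=> /funext ->. Qed.

Lemma cosum_sub T (P Q : R -> (T -> R) -> Prop) F :
  (forall c u, P c u -> Q c u) -> cosum P F -> cosum Q F.
Proof.
by move=> PQ; elim=> [|c u G Pcu _ IH]; [exact: cosum0|apply: cosum_cons; first exact: PQ].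
Qed.

Lemma cosum1 T (P : R -> (T -> R) -> Prop) c u :
  P c u -> cosum P (fun t => c * cos (2 * pi * u t)).
Proof.
by move=> Pcu; apply: cosum_ext (cosum_cons Pcu (cosum0 P)) => t; rewrite addr0.
Qed.

Lemma cosumD T (P : R -> (T -> R) -> Prop) F G :
  cosum P F -> cosum P G -> cosum P (fun t => F t + G t).
Proof.
move=> + SG; elim=> [|c u H Pcu _ IH].
  by apply: cosum_ext SG => t; rewrite add0r.
by apply: cosum_ext (cosum_cons Pcu IH) => t; rewrite addrA.
Qed.

Lemma cosum_sum T (P : R -> (T -> R) -> Prop) I (r : seq I) (F : I -> T -> R) :
  (forall i, cosum P (F i)) -> cosum P (fun t => \sum_(i <- r) F i t).
Proof.
move=> SF; elim: r => [|i r IH].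
  by apply: cosum_ext (cosum0 P) => t; rewrite big_nil.
by apply: cosum_ext (cosumD (SF i) IH) => t; rewrite big_cons.
Qed.

Lemma cosum_comp T U (P : R -> (T -> R) -> Prop) (Q : R -> (U -> R) -> Prop)
    (g : U -> T) F :
  (forall c u, P c u -> Q c (fun t => u (g t))) ->
  cosum P F -> cosum Q (fun t => F (g t)).
Proof.
move=> PQ; elim=> [|c u G Pcu _ IH]; first exact: cosum0.
by apply: cosum_cons IH; exact: PQ.
Qed.

Lemma cosumZ T (P Q : R -> (T -> R) -> Prop) a F :
  (forall c u, P c u -> Q (a * c) u) -> cosum P F -> cosum Q (fun t => a * F t).
Proof.
move=> PQ; elim=> [|c u G Pcu _ IH].
  by apply: cosum_ext (cosum0 Q) => t; rewrite mulr0.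
by apply: cosum_ext (cosum_cons (PQ _ _ Pcu) IH) => t; rewrite [RHS]mulrDr mulrA.
Qed.

Lemma cosM (x y : R) : cos x * cos y = 2^-1 * cos (x + y) + 2^-1 * cos (x - y).
Proof. by rewrite cosD cosB; field. Qed.

(** By the product-to-sum formula, each pair of terms yields the sum phase and the difference phase,
    both with coefficient $cc'/2$; any property stable under these two operations passes to
    products. *)
Lemma cosumM T (P Q S : R -> (T -> R) -> Prop) F G :
  (forall c u c' u', P c u -> Q c' u' ->
     S (c * c' / 2) (fun t => u t + u' t) /\ S (c * c' / 2) (fun t => u t - u' t)) ->
  cosum P F -> cosum Q G -> cosum S (fun t => F t * G t).
Proof.
move=> PQS SF SG; elim: SF => [|c u F' Pcu _ IH].
  by apply: cosum_ext (cosum0 S) => t; rewrite mul0r.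
suff H : cosum S (fun t => c * cos (2 * pi * u t) * G t).
  by apply: cosum_ext (cosumD H IH) => t; rewrite [RHS]mulrDl.
elim: SG => [|c' u' G' Qcu _ {}IH].
  by apply: cosum_ext (cosum0 S) => t; rewrite mulr0.
have [S1 S2] := PQS _ _ _ _ Pcu Qcu.
apply: cosum_ext (cosumD (cosumD (cosum1 S1) (cosum1 S2)) IH) => t.
rewrite [RHS]mulrDr; congr (_ + _).
rewrite mulrACA cosM; set a := 2 * pi * u t; set b := 2 * pi * u' t.
have -> : 2 * pi * (u t + u' t) = a + b by rewrite mulrDr.
have -> : 2 * pi * (u t - u' t) = a - b by rewrite mulrBr.
by ring.
Qed.

Lemma cosum_bounded T (P : R -> (T -> R) -> Prop) F :
  cosum P F -> exists2 M, 0 < M & forall t, `|F t| <= M.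
Proof.
elim=> [|c u G _ _ [M M0 GM]].
  by exists 1 => // t; rewrite normr0.
exists (`|c| + M); first by rewrite ltr_wpDl.
move=> t; apply: (le_trans (ler_normD _ _)); apply: lerD (GM t).
by rewrite normrM ler_piMr // cos_max.
Qed.

(** * Uniform limits of trigonometric polynomials with phases in a given group *)

Section Uniform.
Variables (T : Type) (L : (T -> R) -> Prop).

Definition trig := cosum (fun _ : R => L).

Definition unif (f : T -> R) :=
  forall e, 0 < e -> exists2 p, trig p & forall t, `|f t - p t| <= e.

Lemma trig_unif p : trig p -> unif p.
Proof.
by move=> tp e e0; exists p => // t; rewrite subrr normr0 ltW.
Qed.

Lemma unif_ext f g : f =1 g -> unif f -> unif g.
Proof. by move=> /funext ->. Qed.

Lemma unif_lim f :
  (forall e, 0 < e -> exists2 g, unif g & forall t, `|f t - g t| <= e) -> unif f.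
Proof.
move=> H e e0; have e20 : 0 < e / 2 by rewrite divr_gt0.
have [g ug fg] := H _ e20; have [p tp gp] := ug _ e20.
exists p => // t; rewrite (splitr e).
rewrite (_ : f t - p t = (f t - g t) + (g t - p t)); last by ring.
by apply: (le_trans (ler_normD _ _)); exact: lerD.
Qed.

Lemma unifD f g : unif f -> unif g -> unif (fun t => f t + g t).
Proof.
move=> uf ug e e0; have e20 : 0 < e / 2 by rewrite divr_gt0.
have [p tp fp] := uf _ e20; have [q tq gq] := ug _ e20.
exists (fun t => p t + q t); first exact: cosumD.
move=> t; rewrite (splitr e).
rewrite (_ : _ - _ = (f t - p t) + (g t - q t)); last by ring.
by apply: (le_trans (ler_normD _ _)); exact: lerD.
Qed.

Lemma unif_bounded f : unif f -> exists2 M, 0 < M & forall t, `|f t| <= M.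
Proof.
move=> /(_ _ ltr01)[p /cosum_bounded[M M0 pM] fp].
exists (1 + M); first by rewrite ltr_wpDl.
move=> t; rewrite -(subrK (p t) (f t)).
by apply: (le_trans (ler_normD _ _)); exact: lerD.
Qed.

Hypothesis LD : forall u v, L u -> L v -> L (fun t => u t + v t).
Hypothesis LB : forall u v, L u -> L v -> L (fun t => u t - v t).
Hypothesis L0 : L (fun=> 0).

Lemma trig_cst c : trig (fun=> c).
Proof.
apply: (@cosum_ext _ _ (fun t => c * cos (2 * pi * 0))); last exact: (@cosum1 _ (fun=> L)).
by move=> t; rewrite mulr0 cos0 mulr1.
Qed.

Lemma unif_cst c : unif (fun=> c).
Proof. exact: trig_unif (trig_cst c). Qed.

Lemma trigM f g : trig f -> trig g -> trig (fun t => f t * g t).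
Proof. by apply: cosumM => c u c' u' Lu Lv; split; [exact: LD|exact: LB]. Qed.

Lemma unifM f g : unif f -> unif g -> unif (fun t => f t * g t).
Proof.
move=> uf ug e e0.
have [M M0 gM] := unif_bounded ug.
have [p tp fp] := uf (e / 2 / M) (divr_gt0 (divr_gt0 e0 (ltr0Sn _ 1)) M0).
have [N N0 pN] := cosum_bounded tp.
have [q tq gq] := ug (e / 2 / N) (divr_gt0 (divr_gt0 e0 (ltr0Sn _ 1)) N0).
exists (fun t => p t * q t); first exact: trigM.
move=> t; rewrite (splitr e).
rewrite (_ : _ - _ = (f t - p t) * g t + p t * (g t - q t)); last by ring.
apply: (le_trans (ler_normD _ _)); rewrite !normrM; apply: lerD.
  by rewrite -[leRHS](divfK (lt0r_neq0 M0)); exact: ler_pM.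
by rewrite -[leRHS](divfK (lt0r_neq0 N0)) mulrC; exact: ler_pM.
Qed.

Lemma unifX f n : unif f -> unif (fun t => f t ^+ n).
Proof.
move=> uf; elim: n => [|n IH].
  by apply: unif_ext (unif_cst 1) => t; rewrite expr0.
by apply: unif_ext (unifM uf IH) => t; rewrite exprS.
Qed.

Lemma unif_sum I (r : seq I) (F : I -> T -> R) :
  (forall i, unif (F i)) -> unif (fun t => \sum_(i <- r) F i t).
Proof.
move=> uF; elim: r => [|i r IH].
  by apply: unif_ext (unif_cst 0) => t; rewrite big_nil.
by apply: unif_ext (unifD (uF i) IH) => t; rewrite big_cons.
Qed.

End Uniform.

(** * Integer frequencies in one and two variables, and equidistribution *)

Definition lin1 (u : R -> R) :=
  exists (n : int) b, forall x, u x = n%:~R * x + b.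

Definition lin2 (u : R * R -> R) :=
  exists (m n : int) b, forall z, u z = m%:~R * z.1 + n%:~R * z.2 + b.

Lemma lin1D u v : lin1 u -> lin1 v -> lin1 (fun t => u t + v t).
Proof.
move=> [n [b ub]] [n' [b' vb]]; exists (n + n'), (b + b') => x.
by rewrite ub vb rmorphD /=; ring.
Qed.

Lemma lin1B u v : lin1 u -> lin1 v -> lin1 (fun t => u t - v t).
Proof.
move=> [n [b ub]] [n' [b' vb]]; exists (n - n'), (b - b') => x.
by rewrite ub vb rmorphB /=; ring.
Qed.

Lemma lin1_0 : lin1 (fun=> 0).
Proof. by exists 0, 0 => x; ring. Qed.

Lemma lin2D u v : lin2 u -> lin2 v -> lin2 (fun t => u t + v t).
Proof.
move=> [m [n [b ub]]] [m' [n' [b' vb]]]; exists (m + m'), (n + n'), (b + b') => x.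
by rewrite ub vb !rmorphD /=; ring.
Qed.

Lemma lin2B u v : lin2 u -> lin2 v -> lin2 (fun t => u t - v t).
Proof.
move=> [m [n [b ub]]] [m' [n' [b' vb]]]; exists (m - m'), (n - n'), (b - b') => x.
by rewrite ub vb !rmorphB /=; ring.
Qed.

Lemma lin2_0 : lin2 (fun=> 0).
Proof. by exists 0, 0, 0 => x; ring. Qed.

Lemma unif_comp T U (L : (T -> R) -> Prop) (L' : (U -> R) -> Prop) (g : U -> T) f :
  (forall u, L u -> L' (fun t => u (g t))) -> unif L f -> unif L' (fun t => f (g t)).
Proof.
move=> LL uf e e0; have [p tp fp] := uf _ e0.
by exists (fun t => p (g t)) => //; apply: cosum_comp tp => c u; exact: LL.
Qed.

Lemma trig1_continuous p : trig lin1 p -> continuous p.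
Proof.
elim=> [|c u F [n [b ub]] _ IH]; first exact: cst_continuous.
move=> x; apply: cvgD; last exact: IH.
apply: cvgM; first exact: cvg_cst.
by rewrite (funext ub); exact: continuous_cos_affine.
Qed.

Lemma unif1_continuous f : unif lin1 f -> continuous f.
Proof.
move=> uf x; apply/cvgrPdist_le => e e0.
have e30 : 0 < e / 3 by rewrite divr_gt0.
have [p tp fp] := uf _ e30.
have /cvgrPdist_le/(_ _ e30) px := trig1_continuous tp (x := x).
near=> y.
have pxy : `|p x - p y| <= e / 3 by near: y.
rewrite (_ : f x - f y = (f x - p x) + (p x - p y) + - (f y - p y)); last by ring.
have -> : e = e / 3 + e / 3 + e / 3 by field.
apply: (le_trans (ler_normD _ _)); apply: lerD; last by rewrite normrN.
by apply: (le_trans (ler_normD _ _)); exact: lerD.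
Unshelve. all: by end_near. Qed.

Lemma lin2_snd (x : R) u : lin2 u -> lin1 (fun y => u (x, y)).
Proof.
move=> [m [n [b ub]]]; exists n, (m%:~R * x + b) => y.
by rewrite ub /=; ring.
Qed.

Lemma lin2_diag (k : nat) u : lin2 u -> lin1 (fun x => u (x, k%:R * x)).
Proof.
move=> [m [n [b ub]]]; exists (m + n * k%:Z), b => y.
by rewrite ub /= rmorphD rmorphM /=; ring.
Qed.

(** The weak limit of $x\mapsto F(x,mx)$ as $m\to\infty$, by [equidistribution] below. *)
Definition fiber_mean (F : R * R -> R) x := mean (fun y => F (x, y)).

Lemma fiber_mean_cos c (m n : int) b x :
  fiber_mean (fun z => c * cos (2 * pi * (m%:~R * z.1 + n%:~R * z.2 + b))) x =
  (n == 0)%:R * c * cos (2 * pi * (m%:~R * x + b)).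
Proof.
rewrite /fiber_mean /= meanZ; last first.
  rewrite (_ : (fun _ => _) = fun y => cos (2 * pi * (n%:~R * y + (m%:~R * x + b)))).
    exact: continuous_cos_affine.
  by apply/funext => y; congr (cos (_ * _)); ring.
rewrite (_ : (fun _ => _) = fun y => cos (2 * pi * (n%:~R * y + (m%:~R * x + b)))).
  by rewrite mean_cos mulrCA mulrA.
by apply/funext => y; congr (cos (_ * _)); ring.
Qed.

Lemma trig2_fiber_mean F : trig lin2 F -> trig lin1 (fiber_mean F).
Proof.
elim=> [|c u G Lu tG IH].
  by apply: cosum_ext (trig_cst lin1_0 0) => x; rewrite /fiber_mean mean_cst.
have [m [n [b /funext ub]]] := Lu.
suff H : trig lin1 (fun x => (n == 0)%:R * c * cos (2 * pi * (m%:~R * x + b))).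
  apply: cosum_ext (cosumD H IH) => x; rewrite /fiber_mean meanD //.
  - by congr (_ + _); rewrite -(fiber_mean_cos c m n b) ub.
  - apply: trig1_continuous; apply: (@cosum1 _ (fun=> lin1)).
    exact: lin2_snd.
  - apply: trig1_continuous; apply: cosum_comp tG => d v; exact: lin2_snd.
by apply: (@cosum1 _ (fun=> lin1)); exists m, b.
Qed.

(** On the line $y=mx$ a term of frequencies $(a,n)$ acquires the frequency $a+nm$. If $m>|a|$ this
    vanishes only for $a=n=0$, which are exactly the terms that survive the double mean; so the two
    sides are equal, not merely close. *)
Lemma trig2_equidistribution F : trig lin2 F ->
  exists m0, forall m : nat, (m0 <= m)%N ->
    mean (fun x => F (x, m%:R * x)) = mean (fiber_mean F).
Proof.
elim=> [|c u G Lu tG [m0 IH]].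
  by exists 0%N => m _; rewrite /fiber_mean !mean_cst.
have [a [n [b ub]]] := Lu; exists (maxn m0 `|a|.+1) => m.
rewrite geq_max => /andP[m0m am].
have tU : trig lin2 (fun z => c * cos (2 * pi * u z)) by exact: (@cosum1 _ (fun=> lin2)).
have diagc (H : R * R -> R) : trig lin2 H -> continuous (fun x : R => H (x, m%:R * x)).
  by move=> tH; apply: trig1_continuous; apply: cosum_comp tH => d v; exact: lin2_diag.
have sndc (H : R * R -> R) (x : R) : trig lin2 H -> continuous (fun y => H (x, y)).
  by move=> tH; apply: trig1_continuous; apply: cosum_comp tH => d v; exact: lin2_snd.
rewrite (meanD (diagc _ tU) (diagc _ tG)).
rewrite (_ : fiber_mean _ =
    fun x => fiber_mean (fun z => c * cos (2 * pi * u z)) x + fiber_mean G x); last first.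
  by apply/funext => x; rewrite /fiber_mean (meanD (sndc _ x tU) (sndc _ x tG)).
rewrite meanD; [|exact/trig1_continuous/trig2_fiber_mean..].
rewrite IH //; congr (_ + _).
rewrite (_ : u = fun z => a%:~R * z.1 + n%:~R * z.2 + b); last exact/funext.
rewrite (_ : fiber_mean _ = fun x => (n == 0)%:R * c * cos (2 * pi * (a%:~R * x + b))); last first.
  by apply/funext => x; rewrite fiber_mean_cos.
rewrite (_ : (fun _ => _) =
    fun x => c * cos (2 * pi * ((a + n * m%:Z)%:~R * x + b))); last first.
  by apply/funext => x; rewrite /= rmorphD rmorphM /=; congr (_ * cos (_ * _)); ring.
rewrite !meanZ; [|exact: continuous_cos_affine..].
rewrite !mean_cos; have [->|n0] := eqVneq n 0.
  by rewrite mul0r addr0 mul1r.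
rewrite !mul0r; have -> : (a + n * m%:Z == 0) = false.
  apply/eqP => H; move: am; have : `|a| = (`|n| * m)%N by nia.
  by nia.
by rewrite mul0r mulr0.
Qed.

Lemma unif2_diag F m : unif lin2 F -> unif lin1 (fun x => F (x, m%:R * x)).
Proof. exact: unif_comp (@lin2_diag m). Qed.

Lemma unif2_snd F x : unif lin2 F -> unif lin1 (fun y => F (x, y)).
Proof. exact: unif_comp (@lin2_snd x). Qed.

Lemma unif2_fiber_mean F : unif lin2 F -> unif lin1 (fiber_mean F).
Proof.
move=> uF e e0; have [p tp Fp] := uF _ e0.
exists (fiber_mean p); first exact: trig2_fiber_mean.
move=> x; apply: mean_dist => [||y]; last exact: Fp.
- exact/unif1_continuous/unif2_snd.
- exact/unif1_continuous/unif2_snd/trig_unif.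
Qed.

Lemma equidistribution F : unif lin2 F -> forall e, 0 < e ->
  exists m0, forall m : nat, (m0 <= m)%N ->
    `|mean (fun x => F (x, m%:R * x)) - mean (fiber_mean F)| <= e.
Proof.
move=> uF e e0; have e20 : 0 < e / 2 by rewrite divr_gt0.
have [p tp Fp] := uF _ e20; have up := trig_unif tp.
have [m0 Hm0] := trig2_equidistribution tp; exists m0 => m /Hm0 E.
rewrite (_ : _ - _ = (mean (fun x => F (x, m%:R * x)) - mean (fun x => p (x, m%:R * x)))
  + (mean (fiber_mean p) - mean (fiber_mean F))); last by rewrite E; ring.
rewrite (splitr e); apply: (le_trans (ler_normD _ _)); apply: lerD.
  by apply: mean_dist => //; exact/unif1_continuous/unif2_diag.
apply: mean_dist => [||x]; [exact/unif1_continuous/unif2_fiber_mean..|].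
by apply: mean_dist => [||y]; [exact/unif1_continuous/unif2_snd..|rewrite distrC].
Qed.

End CosineSums.

(** * The binomial series *)

Section BinomialSeries.
Context {R : realType}.
Implicit Types (a s t : R) (n M : nat).

(** This is $(-1)^n\binom{a}{n}$, the coefficient of $s^n$ in $(1-s)^a$. *)
Definition bcoef a n : R := \prod_(i < n) ((i%:R - a) / i.+1%:R).

Definition bpoly a M s : R := \sum_(i < M) bcoef a i * s ^+ i.

Lemma bcoef0 a : bcoef a 0 = 1.
Proof. by rewrite /bcoef big_ord0. Qed.

Lemma bcoefS a n : bcoef a n.+1 = bcoef a n * ((n%:R - a) / n.+1%:R).
Proof. by rewrite /bcoef big_ord_recr. Qed.

Lemma bpolyS a M s : bpoly a M.+1 s = bpoly a M s + bcoef a M * s ^+ M.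
Proof. by rewrite /bpoly big_ord_recr. Qed.

Lemma bcoef_shift a n : bcoef a n.+1 * n.+1%:R = - a * bcoef (a - 1) n.
Proof.
elim: n => [|n IH]; first by rewrite bcoefS !bcoef0; field.
rewrite bcoefS mulrA divfK ?pnatr_eq0 // [in RHS]bcoefS mulrA -IH.
rewrite -(natr1 n); field; rewrite ?natr1 ?pnatr_eq0 //.
Qed.

(** Alternating sums of binomial coefficients telescope: $\sum_{i\le
    M}(-1)^i\binom{a}{i}=(-1)^M\binom{a-1}{M}$. This evaluates the Taylor remainder at the endpoint
    1. *)
Lemma bpoly_at1 a M : bpoly a M.+1 1 = bcoef (a - 1) M.
Proof.
elim: M => [|M IH]; first by rewrite bpolyS /bpoly big_ord0 !bcoef0 expr0 add0r mulr1.
rewrite bpolyS IH expr1n mulr1; have := bcoef_shift a M.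
move/(canRL (mulfK _)) => ->; rewrite ?pnatr_eq0 // bcoefS.
by rewrite -(natr1 M); field; rewrite natr1 pnatr_eq0.
Qed.

Lemma bpoly_at0 a M : bpoly a M.+1 0 = 1.
Proof.
elim: M => [|M IH]; first by rewrite bpolyS /bpoly big_ord0 bcoef0 expr0 add0r mulr1.
by rewrite bpolyS IH expr0n mulr0 addr0.
Qed.

Lemma is_derive_bpoly a M s :
  is_derive s 1 (bpoly a M.+1) (- a * bpoly (a - 1) M s).
Proof.
elim: M => [|M IH].
  rewrite /bpoly big_ord0 mulr0 (_ : (fun _ => _) = cst (bcoef a 0)).
    exact: is_derive_cst.
  by apply/funext => x; rewrite big_ord1 expr0 mulr1.
rewrite (_ : bpoly a M.+2 = bpoly a M.+1 + (fun x => bcoef a M.+1 * x ^+ M.+1)); last first.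
  by apply/funext => x; rewrite bpolyS.
apply: is_derive_eq.
have H2 : is_derive s 1 (fun x => bcoef a M.+1 * x ^+ M.+1) (bcoef a M.+1 * (M.+1%:R * s ^+ M)).
  have H3 : is_derive s 1 (fun x : R => x ^+ M.+1) (M.+1%:R * s ^+ M).
    by split; [exact: exprn_derivable|rewrite exp_derive /GRing.scale /= mulr1].
  have := is_deriveM (is_derive_cst (bcoef a M.+1) s 1) H3; congr is_derive.
  by rewrite /GRing.scale /= mulr0 addr0.
have := is_deriveD IH H2; congr is_derive.
by rewrite bpolyS mulrDr mulrA bcoef_shift mulrA.
Qed.

Lemma is_derive_powR1B a s : s < 1 ->
  is_derive s 1 (fun x => (1 - x) `^ a) (- a * (1 - s) `^ (a - 1)).
Proof.
move=> s1; have s10 : 0 < 1 - s by rewrite subr_gt0.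
have H := is_derive1_powR a s10.
have H1 : is_derive s 1 (fun x : R => 1 - x) (-1) 
  by have := is_deriveB (is_derive_cst (1 : R) s 1) (is_derive_id s 1); congr is_derive; rewrite sub0r.
have := @is_derive1_comp _ _ (fun x : R => 1 - x) _ _ _ H H1; congr is_derive.
by rewrite /GRing.scale /=; ring.
Qed.

(** Weighting the remainder by its first omitted coefficient preserves its shape under
    differentiation: the derivative and [bcoef_shift] each contribute a factor $-a$, and together
    they give a nonnegative square. *)
Lemma is_derive_remainder a M s : s < 1 ->
  is_derive s 1 (fun x => bcoef a M.+1 * ((1 - x) `^ a - bpoly a M.+1 x))
    (a ^+ 2 / M.+1%:R * (bcoef (a - 1) M * ((1 - s) `^ (a - 1) - bpoly (a - 1) M s))).
Proof.
move=> s1; have H1 := is_derive_powR1B a s1; have H2 := is_derive_bpoly a M s.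
have := is_deriveM (is_derive_cst (bcoef a M.+1) s 1) (is_deriveB H1 H2).
congr is_derive; rewrite /= scaler0 addr0 /cst.
have := bcoef_shift a M.
move/(canRL (mulfK _)) => ->; rewrite ?pnatr_eq0 //.
by rewrite /GRing.scale /=; field; rewrite ?natr1 ?pnatr_eq0.
Qed.

(* Taylor's remainder of order [M] has the sign of the next coefficient:
   differentiating turns [a, M.+1] into [a - 1, M]. *)
Lemma bpoly_remainder_sign a M s : 0 <= s -> s < 1 ->
  0 <= bcoef a M * ((1 - s) `^ a - bpoly a M s).
Proof.
elim: M a s => [|M IH] a s s0 s1.
  by rewrite bcoef0 /bpoly big_ord0 mul1r subr0 powR_ge0.
set g := fun x => bcoef a M.+1 * ((1 - x) `^ a - bpoly a M.+1 x).
have dg (x : R) (x1 : x < 1) := is_derive_remainder a M x1; rewrite -/g in dg.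
suff : g 0 <= g s by rewrite {1}/g subr0 powR1 bpoly_at0 subrr mulr0.
apply: (@ger0_derive1_le_cc _ g 0 s) => //; rewrite ?in_itv /= ?lexx ?s0 //.
- by move=> x; rewrite in_itv /= => /andP[_ xs]; have := dg x (lt_trans xs s1); case.
- move=> x; rewrite in_itv /= => /andP[x0 xs].
  have [_ E] := dg x (lt_trans xs s1); rewrite derive1E E.
  by apply: mulr_ge0; [rewrite divr_ge0 ?sqr_ge0|apply: IH; rewrite ?(ltW x0) ?(lt_trans xs)].
- apply: continuous_in_subspaceT => x; rewrite inE /= in_itv /= => /andP[_ xs].
  have [+ _] := dg x (le_lt_trans xs s1).
  by move/derivable1_diffP/differentiable_continuous.
Qed.

(** The weighted remainder [g] is nondecreasing on $[0,1]$ and vanishes at 0, hence is largest at 1,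
    where $(1-s)^a$ vanishes and [bpoly_at1] applies. Dividing by the nonzero weight gives the
    bound. *)
Lemma bpoly_remainder_le a M s : 0 < a -> 0 <= s <= 1 -> bcoef a M.+1 != 0 ->
  `|(1 - s) `^ a - bpoly a M.+1 s| <= `|bcoef (a - 1) M|.
Proof.
move=> a0 /andP[s0 s1] b0.
set g := fun x => bcoef a M.+1 * ((1 - x) `^ a - bpoly a M.+1 x).
have dg (x : R) (x1 : x < 1) := is_derive_remainder a M x1; rewrite -/g in dg.
have g1 : g 1 = - (bcoef a M.+1 * bcoef (a - 1) M).
  by rewrite /g subrr powR0 ?gt_eqF // bpoly_at1 sub0r mulrN.
have cP x : {for x, continuous (bpoly a M.+1)}.
  by apply: differentiable_continuous; apply/derivable1_diffP; case: (is_derive_bpoly a M x).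
have gmono : {in `[0, 1]%R &, {homo g : x y / x <= y}}.
  apply: ger0_derive1_le_cc.
  - by move=> x; rewrite in_itv /= => /andP[_ x1]; case: (dg x x1).
  - move=> x; rewrite in_itv /= => /andP[x0 x1].
    have [_ E] := dg x x1; rewrite derive1E E.
    by apply: mulr_ge0; [rewrite divr_ge0 ?sqr_ge0|apply: bpoly_remainder_sign => //; exact: ltW].
  apply/continuous_within_itvP; first exact: ltr01; split.
  - move=> x; rewrite in_itv /= => /andP[_ x1]; have [+ _] := dg x x1.
    by move/derivable1_diffP/differentiable_continuous.
  - have [+ _] := dg 0 ltr01.
    by move/derivable1_diffP/differentiable_continuous/cvg_at_right_filter.
  (* At 1 the power need not be differentiable; left continuity comes from $t^a\to0$ as $t\to0^+$,
     where $a>0$ enters. *)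
  - rewrite /g; apply: cvgM; first exact: cvg_cst.
    apply: cvgB; last exact: cvg_at_left_filter (cP 1).
    rewrite subrr powR0 ?gt_eqF //.
    apply: (@cvg_comp _ _ _ (fun x : R => 1 - x) (@powR R ^~ a) _ (0^'+)); last exact: powR_cvg0.
    move=> A /= [e e0 eA]; exists e => //= x xe x1; apply: eA => /=.
      by rewrite sub0r normrN.
    by rewrite subr_gt0.
have gs0 : 0 <= g s.
  rewrite (_ : 0 = g 0); first by apply: gmono; rewrite ?in_itv /= ?lexx ?ler01 ?s0.
  by rewrite /g subr0 powR1 bpoly_at0 subrr mulr0.
have gs1 : g s <= g 1 by apply: gmono; rewrite ?in_itv /= ?lexx ?ler01 ?s0.
have : `|g s| <= `|bcoef a M.+1 * bcoef (a - 1) M|.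
  by rewrite -[leRHS]normrN -g1 !ger0_norm // (le_trans gs0 gs1).
by rewrite /g !normrM ler_pM2l // normr_gt0.
Qed.

Lemma bcoef_neq0 a n : (forall m, a != m%:R) -> bcoef a n != 0.
Proof.
move=> aN; elim: n => [|n IH]; first by rewrite bcoef0 oner_eq0.
by rewrite bcoefS !mulf_neq0 ?invr_eq0 ?pnatr_eq0 // subr_eq0 eq_sym.
Qed.

(** From index [q] on, passing to the next coefficient multiplies by $(i-a)/(i+1)>0$. The product of
    two coefficients expresses the common sign without naming it. *)
Lemma bcoef_sign a q n n' : (forall m, a != m%:R) -> a < q%:R ->
  (q <= n)%N -> (q <= n')%N -> 0 < bcoef a n * bcoef a n'.
Proof.
move=> aN aq.
have H k : (q <= k)%N -> 0 < bcoef a q * bcoef a k.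
  move=> /subnKC <-; elim: (k - q)%N => [|j IH].
    by rewrite addn0 -expr2 exprn_even_gt0 //= bcoef_neq0.
  rewrite addnS bcoefS mulrA; apply: mulr_gt0 => //.
  by rewrite divr_gt0 // subr_gt0 (lt_le_trans aq) // ler_nat leq_addr.
move=> /H qn /H qn'; rewrite -(@pmulr_rgt0 _ (bcoef a q ^+ 2)); last first.
  by rewrite exprn_even_gt0 //= bcoef_neq0.
by rewrite expr2 mulrACA mulr_gt0.
Qed.

(** The ratio of consecutive coefficients is $1-a/(n+1)\le\exp(-a/(n+1))$ once $n+1\ge a$, so their
    absolute values are at most a constant times $\exp(-aS_n)$, with $S_n$ the divergent harmonic
    sums. *)
Lemma bcoef_cvg0 a e : 0 < a -> 0 < e ->
  exists M0, forall M, (M0 <= M)%N -> `|bcoef (a - 1) M| <= e.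
Proof.
move=> a0 e0; set S : R ^nat := series harmonic.
have SS n : S n.+1 = S n + n.+1%:R^-1 by rewrite /S /series /= big_nat_recr.
have Soo : S @ \oo --> +oo.
  apply: nondecreasing_dvgn_lt; last exact: dvg_harmonic.
  by apply/nondecreasing_seqP => n; rewrite SS lerDl invr_ge0.
pose m := Num.truncn a; have am : a < m.+1%:R by rewrite truncnS_gt.
pose C := `|bcoef (a - 1) m| * expR (a * S m).
have bound k : `|bcoef (a - 1) (m + k)| <= C * expR (- (a * S (m + k)%N)).
  elim: k => [|k IH]; first by rewrite addn0 /C -mulrA -expRD subrr expR0 mulr1.
  set n := (m + k)%N in IH *; rewrite addnS -/n bcoefS normrM.
  have -> : expR (- (a * S n.+1)) = expR (- (a * S n)) * expR (- (a / n.+1%:R)).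
    by rewrite -expRD -opprD -mulrDr SS.
  rewrite mulrA.
  apply: ler_pM => //.
  have -> : (n%:R - (a - 1)) / n.+1%:R = 1 + - (a / n.+1%:R).
    by rewrite -(natr1 n); field; rewrite natr1 pnatr_eq0.
  rewrite ger0_norm; first exact: expR_ge1Dx.
  rewrite subr_ge0 ler_pdivrMr // mul1r; apply: (le_trans (ltW am)).
  by rewrite ler_nat ltnS leq_addr.
have C0 : 0 <= C by rewrite mulr_ge0 ?expR_ge0.
(* With this threshold $aS_M\ge C/e$, and $\exp(aS_M)\ge1+aS_M$ brings the bound below $e$. *)
have /cvgryPge/(_ (a^-1 * (C / e)))[M0 _ HM0] := Soo.
exists (maxn M0 m) => M; rewrite geq_max => /andP[M0M mM].
rewrite -(subnKC mM); apply: (le_trans (bound _)); rewrite subnKC //.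
rewrite expRN ler_pdivrMr ?expR_gt0 // -ler_pdivrMl // mulrC.
apply: (le_trans _ (expR_ge1Dx _)); apply: (@le_trans _ _ (a * S M)); last by rewrite lerDr.
by rewrite -ler_pdivrMl //; exact: HM0.
Qed.

Lemma bpoly_uniform a e : 0 < a -> (forall m, a != m%:R) -> 0 < e ->
  exists M0, forall M, (M0 <= M)%N ->
    forall s, 0 <= s <= 1 -> `|(1 - s) `^ a - bpoly a M s| <= e.
Proof.
move=> a0 aN e0; have [M0 H] := bcoef_cvg0 a0 e0.
exists M0.+1 => -[//|M] M0M s s01.
exact: le_trans (bpoly_remainder_le a0 s01 (bcoef_neq0 _ aN)) (H _ M0M).
Qed.

End BinomialSeries.

(** * The positive definite kernel *)

Section PositiveDefinite.
Context {R : realType}.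

(** This is $\cos^2(\pi t)=|1+e(t)|^2/4$, with its maximum 1 at the integers and its zeros at the
    half-integers. *)
Definition hcos (t : R) : R := (1 + cos (2 * pi * t)) / 2.

Lemma hcos01 t : 0 <= hcos t <= 1.
Proof. by have := cos_geN1 (2 * pi * t); have := cos_le1 (2 * pi * t); rewrite /hcos; lra. Qed.

Definition harm (n : nat) (c : R) (u : R -> R) :=
  0 <= c /\ exists2 j : int, (`|j| <= n)%N & forall t, u t = j%:~R * t.

Lemma harmM n n' c u c' u' : harm n c u -> harm n' c' u' ->
  harm (n + n') (c * c' / 2) (fun t => u t + u' t) /\
  harm (n + n') (c * c' / 2) (fun t => u t - u' t).
Proof.
move=> [c0 [j jn uj]] [c'0 [j' jn' uj']].
have cc : 0 <= c * c' / 2 by rewrite divr_ge0 // mulr_ge0.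
split; split => //.
  by exists (j + j'); [lia|move=> t; rewrite uj uj' rmorphD mulrDl].
by exists (j - j'); [lia|move=> t; rewrite uj uj' rmorphB mulrBl].
Qed.

Lemma hcos_cosum : cosum (harm 1) hcos.
Proof.
apply: (@cosum_ext _ _ _ (fun t => 2^-1 * cos (2 * pi * (0%:~R * t)) + 2^-1 * cos (2 * pi * (1%:~R * t)))).
  by move=> t; rewrite mul0r mulr0 cos0 mul1r /hcos; field.
apply: (cosumD (F := fun t => 2^-1 * cos (2 * pi * (0%:~R * t))));
  apply: (@cosum1 _ _ (harm 1)); split; rewrite ?invr_ge0 //.
- by exists 0.
- by exists 1.
Qed.

Lemma hcosX_cosum n : cosum (harm n) (fun t => hcos t ^+ n).
Proof.
elim: n => [|n IH].
  apply: cosum_ext (@cosum1 _ _ (harm 0) 1 (fun t => 0%:~R * t) _) => [t|].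
    by rewrite mul0r mulr0 cos0 mul1r expr0.
  by split => //; exists 0.
apply: cosum_ext (cosumM (S := harm n.+1) _ hcos_cosum IH) => [t|c u c' u'].
  by rewrite exprS.
by move=> H H'; have := harmM H H'; rewrite add1n.
Qed.

(** Splits off a positive multiple of the top frequency while all other coefficients stay
    nonnegative; [bterm_main] uses it to get a strictly positive resonant term. *)
Lemma hcosX_top n : exists2 b, 0 < b & exists2 F, cosum (harm n) F &
  forall t, hcos t ^+ n = F t + b * cos (2 * pi * (n%:R * t)).
Proof.
elim: n => [|n [b b0 [F cF HF]]].
  exists 1 => //; exists (fun=> 0); first exact: cosum0.
  by move=> t; rewrite mul0r mulr0 cos0 mulr1 add0r expr0.
(* Multiplying $b\cos(2\pi nt)$ by [hcos] gives $b/2$ at frequency $n$ and $b/4$ at each of $n\pm1$;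
   only the $n+1$ term is kept apart. *)
exists (b / 4); first by rewrite divr_gt0.
exists (fun t => hcos t * F t + (b / 2 * cos (2 * pi * (n%:~R * t))
  + b / 4 * cos (2 * pi * ((n%:Z - 1)%:~R * t)))).
  apply: cosumD.
    apply: (cosumM (S := harm n.+1) _ hcos_cosum cF) => c u c' u' H H'.
    by have := harmM H H'; rewrite add1n.
  apply: (cosumD (F := fun t => b / 2 * cos (2 * pi * (n%:~R * t))));
    apply: (@cosum1 _ _ (harm n.+1)); split; rewrite ?divr_ge0 // ?ltW //.
  - by exists n%:Z.
  - by exists (n%:Z - 1) => //; lia.
move=> t; rewrite exprS HF mulrDr -!addrA; congr (_ + _).
have E : cos (2 * pi * t) * cos (2 * pi * (n%:R * t)) = 
   2^-1 * cos (2 * pi * (n.+1%:R * t)) + 2^-1 * cos (2 * pi * ((n%:Z - 1)%:~R * t)).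
  rewrite mulrC cosM -(natr1 n) rmorphB /=.
  by congr (_ * cos _ + _ * cos _); ring.
rewrite [LHS](_ : _ = b / 2 * cos (2 * pi * (n%:R * t)) +
   b / 2 * (cos (2 * pi * t) * cos (2 * pi * (n%:R * t)))); last by rewrite /hcos; field.
by rewrite E; field.
Qed.

Lemma hcos_unif T (L : (T -> R) -> Prop) u : L (fun=> 0) -> L u ->
  unif L (fun t => hcos (u t)).
Proof.
move=> L0 Lu; apply: trig_unif.
apply: (@cosum_ext _ _ _ (fun t => 2^-1 + 2^-1 * cos (2 * pi * u t))).
  by move=> t; rewrite /hcos; field.
by apply: cosumD; [exact: trig_cst|exact: (@cosum1 _ _ (fun=> L))].
Qed.

(** * The kernel with exponent $a=p/2$ and its strict maximum *)

Section Kernel.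
Variables (a : R) (q : nat).
Hypotheses (a0 : 0 < a) (aN : forall m, a != m%:R) (aq : a < q%:R).

Let q0 : (0 < q)%N.
Proof. by rewrite -(ltr_nat R) (lt_trans a0). Qed.

Definition phase1 (z : R * R) : R := q.+1%:R * z.2 - z.1.
Definition phase2 (z : R * R) : R := q%:R * z.2 - z.1.

(* Monomials in (z, y) whose mean over y is, as a function of z, maximal at 0:
   either the mean vanishes, or it is constant, or the coefficient is >= 0. *)
Definition tame (c : R) (u : R * R -> R) :=
  exists2 mk : int * int, (forall z, u z = mk.2%:~R * z.2 - mk.1%:~R * z.1) &
    [|| 0 <= c, mk.2 != 0 | mk.1 == 0].

Lemma tame_lin2 F : cosum tame F -> trig lin2 F.
Proof.
apply: cosum_sub => c u [[m k] H _]; exists (- m), k, 0 => z.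
by rewrite H /= rmorphN /=; ring.
Qed.

Lemma tame_fiber_mean_max F z : cosum tame F -> fiber_mean F z <= fiber_mean F 0.
Proof.
have sndc (H : R * R -> R) (x : R) : trig lin2 H -> continuous (fun y => H (x, y)).
  by move=> tH; apply: trig1_continuous; apply: cosum_comp tH => d v; exact: lin2_snd.
elim=> [|c u G Hu cG IH]; first by rewrite /fiber_mean mean_cst.
have tu : trig lin2 (fun z => c * cos (2 * pi * u z)).
  by apply: tame_lin2; exact: cosum1.
have tG := tame_lin2 cG.
rewrite /fiber_mean !(meanD (sndc _ _ tu) (sndc _ _ tG)); apply: lerD; last exact: IH.
case: Hu => -[m k] /= Hu.
have -> : u = (fun z => (- m)%:~R * z.1 + k%:~R * z.2 + 0).
  by apply/funext => w; rewrite Hu rmorphN /=; ring.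
rewrite -/(fiber_mean (fun z => c * cos (2 * pi * ((- m)%:~R * z.1 + k%:~R * z.2 + 0))) z).
rewrite -/(fiber_mean (fun z => c * cos (2 * pi * ((- m)%:~R * z.1 + k%:~R * z.2 + 0))) 0).
rewrite !fiber_mean_cos !mulr0 !addr0 mulr0 cos0.
have [_|] := eqVneq k 0; last by rewrite !mul0r.
rewrite /= !mul1r mulr1 => /orP[c_ge0|/eqP ->].
  by rewrite ler_piMr // cos_le1.
by rewrite oppr0 mul0r mulr0 cos0 mulr1.
Qed.

(** A product of harmonics $j$ and $j'$ has $y$-frequency $j(q+1)+sj'q$ with $s=\pm1$. If it
    vanishes, then $t=j+sj'$ satisfies $j=-qt$ and $sj'=(q+1)t$. Degrees below $q$ or below $q+1$
    thus force $t=0$, a term constant in $z$; in the remaining case the sign of [b] decides. *)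
Lemma tame_product n n' (b : R) F F' :
  [|| 0 <= b, (n < q)%N | (n' < q.+1)%N] ->
  cosum (harm n) F -> cosum (harm n') F' ->
  cosum tame (fun z => b * (F (phase1 z) * F' (phase2 z))).
Proof.
move=> H cF cF'.
pose Q1 c u := 0 <= c :> R /\ exists2 j : int, (`|j| <= n)%N & forall z, u z = j%:~R * phase1 z.
pose Q2 c u := 0 <= c :> R /\ exists2 j : int, (`|j| <= n')%N & forall z, u z = j%:~R * phase2 z.
have c1 : cosum Q1 (fun z => F (phase1 z)).
  by apply: cosum_comp cF => c u [c0 [j jn ju]]; split=> //; exists j.
have c2 : cosum Q2 (fun z => F' (phase2 z)).
  by apply: cosum_comp cF' => c u [c0 [j jn ju]]; split=> //; exists j.
apply: (@cosumZ _ _ (fun c => tame (b * c))) => //.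
apply: (cosumM _ c1 c2) => c u c' u' [c0 [j jn ju]] [c'0 [j' jn' ju']].
have cc : 0 <= c * c' / 2 by rewrite divr_ge0 // mulr_ge0.
have key (s : int) : `|s|%N = 1%N ->
   [|| 0 <= b * (c * c' / 2), j * q.+1%:Z + s * j' * q%:Z != 0 | j + s * j' == 0].
  move=> s1; case/or3P: H => [b0|nq|n'q]; first by rewrite mulr_ge0.
    apply/orP; right; rewrite -implyNb negbK; apply/implyP => /eqP E.
    have : j = - q%:Z * (j + s * j') by lia.
    by move: (j + s * j') => t Et; nia.
  apply/orP; right; rewrite -implyNb negbK; apply/implyP => /eqP E.
  have {}E : s * j' = q.+1%:Z * (j + s * j') by lia.
  have : absz (s * j') = absz j' by rewrite abszM s1 mul1n.
  by move: (s * j') (j + _) E => r t E; nia.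
split.
  exists (j + 1 * j', j * q.+1%:Z + 1 * j' * q%:Z); last exact: key.
  by move=> z /=; rewrite ju ju' /phase1 /phase2 !rmorphD !rmorphM /=; ring.
exists (j + (-1) * j', j * q.+1%:Z + (-1) * j' * q%:Z); last exact: key.
by move=> z /=; rewrite ju ju' /phase1 /phase2 !rmorphD !rmorphM /= rmorphN /=; ring.
Qed.

Definition bterm (n n' : nat) (z : R * R) : R :=
  bcoef a n * hcos (phase1 z) ^+ n * (bcoef a n' * hcos (phase2 z) ^+ n').

(** Resonance requires $n\ge q$ and $n'\ge q+1$, and there the two binomial coefficients have the
    same sign. *)
Lemma bterm_tame n n' : cosum tame (bterm n n').
Proof.
apply: cosum_ext (@tame_product n n' (bcoef a n * bcoef a n') _ _ _
   (hcosX_cosum n) (hcosX_cosum n')) => [z|]; first by rewrite mulrACA.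
case: (ltnP n q) => nq; first by rewrite orbT.
case: (ltnP n' q.+1) => n'q; first by rewrite !orbT.
by rewrite ltW //; apply: (bcoef_sign aN aq) => //; exact: ltnW.
Qed.

(** The degrees $(q,q+1)$ are the lowest at which resonance occurs: $q\,((q+1)y-z)-(q+1)(qy-z)=z$.
    The difference phase of the two top harmonics is therefore free of $y$ and yields $\cos(2\pi z)$
    with a positive coefficient. *)
Lemma bterm_main : exists2 eta, 0 < eta & exists2 K, cosum tame K &
  forall z, bterm q q.+1 z = K z + eta * cos (2 * pi * z.1).
Proof.
have [b b0 [F cF HF]] := hcosX_top q.
have [b' b'0 [F' cF' HF']] := hcosX_top q.+1.
have B0 : 0 < bcoef a q * bcoef a q.+1 by apply: (bcoef_sign aN aq).
set B := bcoef a q * bcoef a q.+1 in B0.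
exists (B * (b * b') / 2); first by rewrite divr_gt0 // mulr_gt0 // mulr_gt0.
have c1 : cosum (harm q) (fun t => b * cos (2 * pi * (q%:R * t))).
  by apply: (@cosum1 _ _ (harm q)); split; [exact: ltW|exists q].
have c2 : cosum (harm q.+1) (fun t => b' * cos (2 * pi * (q.+1%:R * t))).
  by apply: (@cosum1 _ _ (harm q.+1)); split; [exact: ltW|exists q.+1].
have BH : [|| 0 <= B, (q < q)%N | (q.+1 < q.+1)%N] by rewrite ltW.
exists (fun z => B * (F (phase1 z) * F' (phase2 z))
  + (B * ((b * cos (2 * pi * (q%:R * phase1 z))) * F' (phase2 z))
  + (B * (F (phase1 z) * (b' * cos (2 * pi * (q.+1%:R * phase2 z))))
  + (B * (b * b') / 2) * cos (2 * pi * ((q * q.+1 + q * q.+1)%:R * z.2 - (q + q.+1)%:R * z.1))))).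
  apply: cosumD; first exact: (tame_product BH).
  apply: cosumD; first exact: (tame_product BH c1 cF').
  apply: cosumD; first exact: (tame_product BH cF c2).
  apply: cosum1; exists ((q + q.+1)%:Z, (q * q.+1 + q * q.+1)%:Z) => //.
  by rewrite /= ltW // divr_gt0 // mulr_gt0 // mulr_gt0.
move=> z; rewrite /bterm HF HF'.
have E := cosM (2 * pi * (q%:R * phase1 z)) (2 * pi * (q.+1%:R * phase2 z)).
have E1 : 2 * pi * (q%:R * phase1 z) + 2 * pi * (q.+1%:R * phase2 z) =
  2 * pi * ((q * q.+1 + q * q.+1)%:R * z.2 - (q + q.+1)%:R * z.1) :> R.
  by rewrite /phase1 /phase2 !natrD !natrM -!natr1; ring.
have E2 : 2 * pi * (q%:R * phase1 z) - 2 * pi * (q.+1%:R * phase2 z) = 2 * pi * z.1.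
  by rewrite /phase1 /phase2 -!natr1; ring.
rewrite E1 E2 in E.
move: E; set X := cos (2 * pi * (q%:R * _)); set Y := cos (2 * pi * (q.+1%:R * _)).
set C1 := cos _; set C2 := cos _ => E.
have -> : C2 = 2 * (X * Y) - C1 by rewrite E; field.
by rewrite /B; field.
Qed.

Definition bkernel M (z : R * R) : R :=
  bpoly a M (hcos (phase1 z)) * bpoly a M (hcos (phase2 z)).

(** [eta] comes from the single term of degrees $(q,q+1)$, so it does not depend on the truncation
    [M] and survives the limit $M\to\infty$. *)
Lemma bkernel_gap : exists2 eta, 0 < eta & forall M z, (q.+1 < M)%N ->
  fiber_mean (bkernel M) z + eta * (1 - cos (2 * pi * z)) <= fiber_mean (bkernel M) 0.
Proof.
have [eta eta0 [K cK HK]] := bterm_main; exists eta => // M z qM.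
(* The double expansion of the kernel, with $\eta\cos(2\pi z)$ removed from the resonant term; all
   that is left is tame. *)
pose t n n' := if (n == q) && (n' == q.+1) then K else bterm n n'.
pose H w := \sum_(n < M) \sum_(n' < M) t n n' w.
have cH : cosum tame H.
  apply: cosum_sum => n; apply: cosum_sum => n'.
  by rewrite /t; case: (_ && _); [exact: cK|exact: bterm_tame].
have GE w : bkernel M w = H w + eta * cos (2 * pi * w.1).
  rewrite /bkernel /bpoly big_distrl /= /H.
  have qM' : (q < M)%N by exact: ltnW.
  rewrite (bigD1 (Ordinal qM')) //= [in RHS](bigD1 (Ordinal qM')) //=.
  rewrite big_distrr /= (bigD1 (Ordinal qM)) //= [in RHS](bigD1 (Ordinal qM)) //=.
  rewrite {1}/t !eqxx /= -/(bterm q q.+1 w) HK -!addrA; congr (_ + _).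
  rewrite addrC -addrA; congr (_ + _).
    by apply: eq_bigr => i; rewrite -val_eqE /= /t => /negPf ->; rewrite andbF.
  congr (_ + _); apply: eq_bigr => i; rewrite -val_eqE /= big_distrr /= => /negPf iq.
  by apply: eq_bigr => j _; rewrite /t iq.
have tH := tame_lin2 cH.
have GH x : fiber_mean (bkernel M) x = fiber_mean H x + eta * cos (2 * pi * x).
  rewrite /fiber_mean; under eq_fun do rewrite GE /=.
  rewrite meanD ?mean_cst //; last exact: cst_continuous.
  by apply: trig1_continuous; apply: cosum_comp tH => d v; exact: lin2_snd.
rewrite !GH mulr0 cos0; have := tame_fiber_mean_max z cH; lra.
Qed.

Lemma powR1B_le1 (s : R) : 0 <= s <= 1 -> `|(1 - s) `^ a| <= 1.
Proof.
move=> /andP[s0 s1]; rewrite ger0_norm ?powR_ge0 //.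
rewrite -[leRHS](congr1 (fun f => f a) (@powR1 R)).
apply: ge0_ler_powR; rewrite ?nnegrE ?subr_ge0 ?(ltW a0) //.
by rewrite gerBl.
Qed.

Lemma powR1B_unif T (L : (T -> R) -> Prop) (f : T -> R) :
  (forall u v, L u -> L v -> L (fun t => u t + v t)) ->
  (forall u v, L u -> L v -> L (fun t => u t - v t)) ->
  L (fun=> 0) -> unif L f -> (forall t, 0 <= f t <= 1) ->
  unif L (fun t => (1 - f t) `^ a).
Proof.
move=> LD LB L0 uf f01; apply: unif_lim => e e0.
have [M0 H] := bpoly_uniform a0 aN e0.
exists (fun t => bpoly a M0 (f t)); last by move=> t; exact: H.
apply: unif_sum => // i; apply: unifM => //; first exact: unif_cst.
exact: unifX.
Qed.

(* The integrand of G, up to the factor 4^p and with x = 1/2 + z. *)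
Definition shifted_kernel (z : R * R) : R :=
  (1 - hcos (phase1 z)) `^ a * (1 - hcos (phase2 z)) `^ a.

Lemma phase1_lin2 : lin2 phase1.
Proof. by exists (-1), q.+1, 0 => z; rewrite /phase1 rmorphN /=; ring. Qed.

Lemma phase2_lin2 : lin2 phase2.
Proof. by exists (-1), q, 0 => z; rewrite /phase2 rmorphN /=; ring. Qed.

Lemma kernel_unif : unif lin2 shifted_kernel.
Proof.
apply: unifM; [exact: lin2D|exact: lin2B| |].
- apply: powR1B_unif (lin2D) (lin2B) lin2_0 _ _ => [|t]; last exact: hcos01.
  exact: hcos_unif lin2_0 phase1_lin2.
- apply: powR1B_unif (lin2D) (lin2B) lin2_0 _ _ => [|t]; last exact: hcos01.
  exact: hcos_unif lin2_0 phase2_lin2.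
Qed.

Lemma kernel_gap : exists2 eta, 0 < eta & forall z,
  fiber_mean shifted_kernel z + eta * (1 - cos (2 * pi * z)) <= fiber_mean shifted_kernel 0.
Proof.
have [eta eta0 H] := bkernel_gap; exists eta => // z.
apply/ler_addgt0Pl => e e0.
(* An error $d\le1$ in each factor bounds the partial sums by 2 and costs at most $d+2d=3d$ in the
   product. The comparison at both $z$ and 0 costs $6d\le e$. *)
pose d := Num.min 1 (e / 6).
have d0 : 0 < d by rewrite lt_min ltr01 divr_gt0.
have d1 : d <= 1 by rewrite ge_min lexx.
have de : d <= e / 6 by rewrite ge_min lexx orbT.
have [M0 HM] := bpoly_uniform a0 aN d0.
set M := maxn M0 q.+2; have {}HM := HM M (leq_maxl _ _).
have := H M z (leq_maxr _ _); set P := bkernel M => HG.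
have uP : unif lin2 P.
  have ub u : lin2 u -> unif lin2 (fun z => bpoly a M (hcos (u z))).
    move=> lu; apply: (unif_sum lin2_0) => i.
    apply: (unifM lin2D lin2B); first exact: unif_cst lin2_0 _.
    exact/(unifX lin2D lin2B lin2_0)/(hcos_unif lin2_0).
  by apply: (unifM lin2D lin2B); apply: ub; [exact: phase1_lin2|exact: phase2_lin2].
have kP w : `|shifted_kernel w - P w| <= 3 * d.
  rewrite /shifted_kernel /P /bkernel; set s := hcos (phase1 w); set t := hcos (phase2 w).
  have Hs := HM s (hcos01 _); have Ht := HM t (hcos01 _).
  have s1 := powR1B_le1 (hcos01 (phase1 w)); rewrite -/s in s1.
  rewrite (_ : _ - _ = (1 - s) `^ a * ((1 - t) `^ a - bpoly a M t)
     + ((1 - s) `^ a - bpoly a M s) * bpoly a M t); last by ring.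
  have bt : `|bpoly a M t| <= 2.
    rewrite -(subrK ((1 - t) `^ a) (bpoly a M t)).
    apply: (le_trans (ler_normD _ _)); rewrite distrC.
    by have := powR1B_le1 (hcos01 (phase2 w)); rewrite -/t; lra.
  apply: (le_trans (ler_normD _ _)); rewrite !normrM.
  have -> : 3 * d = 1 * d + d * 2 by ring.
  by apply: lerD; exact: ler_pM.
have mP x : `|fiber_mean shifted_kernel x - fiber_mean P x| <= 3 * d.
  apply: mean_dist => [||y]; last exact: kP.
  - exact/unif1_continuous/unif2_snd/kernel_unif.
  - exact/unif1_continuous/unif2_snd.
have := mP z; have := mP 0; rewrite !ler_norml => /andP[? ?] /andP[? ?].
lra.
Qed.

End Kernel.
End PositiveDefinite.

(** * Riesz products *)

Section Spectra.
Local Open Scope fset_scope.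
Implicit Types (H : {fset nat}) (A N : nat).

(** Demanded of all pairs rather than of consecutive elements, a form that passes directly to unions
    of translates. *)
Definition sparse N H := forall h h', h \in H -> h' \in H -> (h < h')%N -> (N < h' - h)%N.

(** The spectrum of $f(x)(1+e(Ax))$ when [A] exceeds every element of [H]: the two copies are then
    disjoint and the product is again an idempotent. *)
Definition shift_union H A : {fset nat} := H `|` [fset (h + A)%N | h in H].

Lemma mem_shift_union H A k :
  (k \in shift_union H A) = (k \in H) || (A <= k)%N && ((k - A)%N \in H).
Proof.
rewrite /shift_union in_fsetU; congr (_ || _); apply/imfsetP/andP => [[h /= hH ->]|[Ak kH]].
  by rewrite leq_addl addnK.
by exists (k - A)%N => //; rewrite subnK.
Qed.

Lemma shift_union_perm H A : (forall h, h \in H -> (h < A)%N) ->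
  perm_eq (shift_union H A) (enum_fset H ++ [seq (h + A)%N | h <- enum_fset H]).
Proof.
move=> HA; apply: uniq_perm; first exact: fset_uniq.
  rewrite cat_uniq fset_uniq map_inj_uniq ?fset_uniq ?andbT /=; last exact: addIn.
  by apply/hasPn => _ /mapP[h hH ->]; apply/negP => /HA; rewrite ltnNge leq_addl.
move=> k; rewrite mem_shift_union mem_cat; congr (_ || _).
apply/andP/mapP => [[Ak kH]|[h hH ->]]; last by rewrite leq_addl addnK.
by exists (k - A)%N; rewrite ?subnK.
Qed.

Lemma shift_union_sparse N H A : sparse N H -> (forall h, h \in H -> (h + N < A)%N) ->
  sparse N (shift_union H A).
Proof.
move=> sH HA h h'; rewrite !mem_shift_union.
case/orP=> [hH|/andP[Ah hH]]; case/orP=> [h'H|/andP[Ah' h'H]] hh'.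
- exact: sH.
- by have := HA _ hH; lia.
- by have := HA _ h'H; lia.
- by have := sH _ _ hH h'H; lia.
Qed.

Lemma shift_union_neq0 H A : H != fset0 -> shift_union H A != fset0.
Proof.
by case/fset0Pn => h hH; apply/fset0Pn; exists h; rewrite mem_shift_union hH.
Qed.

Lemma fset_nat_bounded H : exists K, forall h, h \in H -> (h <= K)%N.
Proof.
exists (\max_(h <- H) h)%N => h hH.
exact: (leq_bigmax_seq h hH isT).
Qed.

Lemma sparse_gaps N H : sparse N H -> gaps_larger N H.
Proof. by move=> sH h h' hH h'H hh' _; exact: sH. Qed.

End Spectra.

(** * Moduli of exponential sums *)

Section Exponentials.
Context {R : realType}.
Implicit Types (H : {fset nat}) (x y t p : R).

Local Notation normc := ComplexField.Normc.normc.

Lemma e2piD x y : e2pi (x + y) = e2pi x * e2pi y.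
Proof.
rewrite /e2pi mulrDr cosD sinD; apply/eqP; rewrite eq_complex /=.
by rewrite eqxx addrC eqxx.
Qed.

Lemma exp_sum_shift_union H A x : (forall h, h \in H -> (h < A)%N) ->
  exp_sum (shift_union H A) x = exp_sum H x * (1 + e2pi (A%:R * x)).
Proof.
move=> HA; rewrite /exp_sum.
rewrite (perm_big _ (shift_union_perm HA)) big_cat big_map mulrDr mulr1 /=; congr (_ + _).
by rewrite big_distrl /=; apply: eq_bigr => h _; rewrite natrD mulrDl e2piD.
Qed.

Definition amp p H x : R := normc (exp_sum H x) `^ p.

Lemma normc_sqr (z : R[i]) : normc z ^+ 2 = complex.Re z ^+ 2 + complex.Im z ^+ 2.
Proof. by case: z => u v; rewrite /= sqr_sqrtr // addr_ge0 ?sqr_ge0. Qed.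

Lemma normc_ge0 (z : R[i]) : 0 <= normc z.
Proof. by case: z => u v; exact: sqrtr_ge0. Qed.

Lemma normc_powR (z : R[i]) p : normc z `^ p = (normc z ^+ 2) `^ (p / 2).
Proof.
rewrite -powR_mulrn ?normc_ge0 // -powRrM; congr (_ `^ _).
by field.
Qed.

Lemma normc1De2pi t : normc (1 + e2pi t) ^+ 2 = 4 * hcos t.
Proof.
rewrite normc_sqr /e2pi /= /hcos add0r.
have := cos2Dsin2 (2 * pi * t).
set c := cos _; set s := sin _ => E.
rewrite (_ : (1 + c) ^+ 2 + s ^+ 2 = 1 + 2 * c + (c ^+ 2 + s ^+ 2)); last by ring.
by rewrite E; field.
Qed.

Lemma hcosBhalf t : hcos (t - 2^-1) = 1 - hcos t.
Proof.
rewrite /hcos mulrBr (_ : 2 * pi * 2^-1 = pi); last by rewrite mulrAC divff ?mul1r.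
by rewrite -[in RHS](subrK pi (2 * pi * t)) cosDpi; field.
Qed.

Lemma amp_shift_union p H A x : (forall h, h \in H -> (h < A)%N) ->
  amp p (shift_union H A) x = amp p H x * (4 * hcos (A%:R * x)) `^ (p / 2).
Proof.
move=> HA; rewrite /amp exp_sum_shift_union // ComplexField.Normc.normcM.
rewrite -normc1De2pi -normc_powR; apply: powRM; exact: normc_ge0.
Qed.

End Exponentials.

(** * Riesz products distributed like powers of a profile *)

Section RieszProducts.
Context {R : realType}.
Variables (p : R) (q : nat).
Hypotheses (p0 : 0 < p) (pN : forall m, p / 2 != m%:R) (pq : p / 2 < q%:R).

Let a0 : 0 < p / 2. Proof. by rewrite divr_gt0. Qed.
Let q0 : (0 < q)%N. Proof. by rewrite -(ltr_nat R) (lt_trans a0). Qed.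

(** At $(x,y)$ this is $|1+e((q+1)y-x)|^p\,|1+e(qy-x)|^p$; the shift by $1/2$ turns [1 - hcos] into
    [hcos]. Its mean over $y$, [profile], is the function $G$. *)
Definition weight (z : R * R) : R := 4 `^ p * shifted_kernel (p / 2) q (z.1 - 2^-1, z.2).

Definition profile := fiber_mean weight.

Lemma weight_unif : unif lin2 weight.
Proof.
apply: (unifM lin2D lin2B); first exact: unif_cst lin2_0 _.
apply: (@unif_comp _ _ _ lin2 lin2 (fun z : R * R => (z.1 - 2^-1, z.2)) _ _
  (kernel_unif q a0 pN)) => u [m [n [b ub]]].
by exists m, n, (b - m%:~R * 2^-1) => z; rewrite ub /=; ring.
Qed.

Lemma weight_ge0 z : 0 <= weight z.
Proof. by rewrite /weight /shifted_kernel !mulr_ge0 ?powR_ge0. Qed.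

Lemma weight_factors (m : nat) x : (0 < m)%N ->
  (4 * hcos ((q * m).-1%:R * x)) `^ (p / 2) * (4 * hcos ((q.+1 * m).-1%:R * x)) `^ (p / 2)
  = weight (x, m%:R * x).
Proof.
move=> m0; rewrite /weight /shifted_kernel /=.
have h0 t : 0 <= hcos t :> R by case/andP: (hcos01 t).
have -> : (4 : R) `^ p = 4 `^ (p / 2) * 4 `^ (p / 2) by rewrite -powRD ?gt_eqF ?implybT // -splitr.
have E (k : nat) : (0 < k)%N ->
   1 - hcos (k%:R * (m%:R * x) - (x - 2^-1)) = hcos ((k * m).-1%:R * x).
  move=> k0; rewrite -hcosBhalf; congr hcos.
  have km : (k * m = (k * m).-1.+1)%N by rewrite prednK // muln_gt0 k0.
  by rewrite mulrA -natrM {1}km -natr1; ring.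
rewrite /phase1 /phase2 /= !E // !powRM //; ring.
Qed.

Lemma profile_unif : unif lin1 profile.
Proof. exact/unif2_fiber_mean/weight_unif. Qed.

Lemma profile_ge0 x : 0 <= profile x.
Proof. by apply: mean_ge0 => y; exact: weight_ge0. Qed.

(** This is [kernel_gap] at $z=x-1/2$, where $1-\cos(2\pi z)=2\,$[hcos x]; hence the extra factor 2
    in the constant. *)
Lemma profile_gap : exists2 eta, 0 < eta & forall x,
  profile x + eta * hcos x <= profile 2^-1.
Proof.
have [eta eta0 H] := kernel_gap a0 pN pq.
have c0 : (0 : R) < 4 `^ p by rewrite powR_gt0.
exists (4 `^ p * (eta * 2)); first by rewrite !mulr_gt0.
have PE x : profile x = 4 `^ p * fiber_mean (shifted_kernel (p / 2) q) (x - 2^-1).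
  rewrite /profile /fiber_mean meanZ //.
  exact: (unif1_continuous (unif2_snd (x - 2^-1) (kernel_unif q a0 pN))).
move=> x; rewrite !PE subrr -mulrA -mulrDr ler_pM2l //.
have := H (x - 2^-1); have := hcosBhalf x; rewrite /hcos.
have -> : cos (2 * pi * (x - 2^-1)) = - cos (2 * pi * x).
  have := hcosBhalf x; rewrite /hcos; lra.
by move=> _; apply: le_trans; rewrite lerD2l; lra.
Qed.

(** Induction on [L] with the test functions quantified inside: the hypothesis is applied to
    $u\cdot$[profile], and then one new pair of factors is equidistributed. Two test functions are
    carried together because one spectrum must serve both the total mass and the mass away from
    $1/2$. *)
Lemma riesz_products L : forall (u1 u2 : R -> R) (e : R) (N : nat),
  unif lin1 u1 -> unif lin1 u2 -> 0 < e ->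
  exists H, [/\ H != fset0, sparse N H, unif lin1 (amp p H) &
    forall u, u = u1 \/ u = u2 ->
    `|mean (fun x => u x * amp p H x) - mean (fun x => u x * profile x ^+ L)| <= e].
Proof.
elim: L => [|L IH] u1 u2 e N U1 U2 e0.
  have ampE : amp p [fset 0%N]%fset = fun=> 1.
    apply/funext => x; rewrite /amp /exp_sum big_seq_fset1 mul0r /e2pi mulr0 cos0 sin0 /=.
    by rewrite expr1n expr0n addr0 sqrtr1 powR1.
  exists [fset 0%N]%fset; split.
  - by apply/fset0Pn; exists 0%N; rewrite inE.
  - by move=> h h'; rewrite !inE => /eqP -> /eqP ->.
  - by rewrite ampE; exact: unif_cst lin1_0 _.
  - by move=> u _; rewrite ampE subrr normr0 ltW.
have e20 : 0 < e / 2 by rewrite divr_gt0.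
have uP u : unif lin1 u -> unif lin1 (fun x => u x * profile x).
  by move=> uu; apply: (unifM lin1D lin1B uu); exact: profile_unif.
have [H [H0 sH uH HE]] := IH _ _ _ N (uP _ U1) (uP _ U2) e20.
have fstu u : unif lin1 u -> unif lin2 (fun z : R * R => u z.1).
  apply: (@unif_comp _ _ _ lin1 lin2 (fun z : R * R => z.1)) => v [n [b vb]]; exists n, 0, b => z.
  by rewrite vb /=; ring.
pose F u (z : R * R) := u z.1 * amp p H z.1 * weight z.
have FU u : unif lin1 u -> unif lin2 (F u).
  move=> uu; apply: (unifM lin2D lin2B); last exact: weight_unif.
  by apply: (unifM lin2D lin2B); exact: fstu.
have [m1 Hm1] := equidistribution (FU _ U1) e20.
have [m2 Hm2] := equidistribution (FU _ U2) e20.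
have [K HK] := fset_nat_bounded H.
(* Beyond [m1] and [m2] equidistribution holds for both test functions. Since $B-A=m>K+N$ and $A\ge
   m-1>K+N$, each translate starts more than [N] above the previous spectrum. *)
pose m := (m1 + m2 + K + N + 2)%N.
have m0 : (0 < m)%N by rewrite /m addn2.
pose A := (q * m).-1; pose B := (q.+1 * m).-1.
have HA h : h \in H -> (h + N < A)%N by move=> /HK; rewrite /A /m; nia.
have HB h : h \in shift_union H A -> (h + N < B)%N.
  rewrite mem_shift_union => /orP[/HK|/andP[Ah /HK]]; rewrite /A /B /m; nia.
have HA' h : h \in H -> (h < A)%N by move=> /HA; apply: leq_ltn_trans; rewrite leq_addr.
have HB' h : h \in shift_union H A -> (h < B)%N.
  by move=> /HB; apply: leq_ltn_trans; rewrite leq_addr.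
have ampE x : amp p (shift_union (shift_union H A) B) x = amp p H x * weight (x, m%:R * x).
  by rewrite !amp_shift_union // -mulrA weight_factors.
exists (shift_union (shift_union H A) B); split.
- by do 2 apply: shift_union_neq0.
- by apply: shift_union_sparse => //; apply: shift_union_sparse.
- apply: (@unif_ext _ _ _ (fun x => (fun z => amp p H z.1 * weight z) (x, m%:R * x))).
    by move=> x; rewrite ampE.
  apply: (@unif2_diag _ (fun z => amp p H z.1 * weight z) m).
  apply: (unifM lin2D lin2B); first exact: fstu.
  exact: weight_unif.
move=> u Hu.
have uu : unif lin1 u by case: Hu => ->.
have E1 : `|mean (fun x => F u (x, m%:R * x)) - mean (fiber_mean (F u))| <= e / 2.
  by case: Hu => ->; [apply: Hm1|apply: Hm2]; rewrite /m; lia.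
have E2 : `|mean (fun x => u x * profile x * amp p H x)
    - mean (fun x => u x * profile x * profile x ^+ L)| <= e / 2.
  by case: Hu => ->; apply: HE; [left|right].
have E3 : fiber_mean (F u) = fun x => u x * profile x * amp p H x.
  apply/funext => x; rewrite /fiber_mean /F /= meanZ; last first.
    exact/unif1_continuous/unif2_snd/weight_unif.
  by rewrite -/(fiber_mean weight x) -/profile mulrAC.
rewrite (_ : (fun x => u x * amp p _ x) = fun x => F u (x, m%:R * x)); last first.
  by apply/funext => x; rewrite ampE /F mulrA.
rewrite (_ : (fun x => u x * profile x ^+ L.+1) = fun x => u x * profile x * profile x ^+ L); last first.
  by apply/funext => x; rewrite exprS mulrA.
rewrite E3 in E1; rewrite (splitr e); set X := mean _; set Y := mean _.
by apply: (le_trans (ler_distD _ _ _)); exact: lerD E1 E2.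
Qed.

End RieszProducts.

(** * Exponents that are not even integers *)

Section Mass.
Context {R : realType}.
Implicit Types (E : set R) (f g v : R -> R).

Definition mass E g : R := \int[lebesgue_measure]_(x in E `&` `[0, 1[) g x.

Lemma integrable_mass E g : measurable E -> continuous g ->
  lebesgue_measure.-integrable (E `&` `[0, 1[) (EFin \o g).
Proof.
move=> mE cg; apply: (@integrableS _ _ _ lebesgue_measure `[0%R, 1%R[) => //.
- exact: measurableI.
- exact: integrable01.
Qed.

Lemma mean_mass E g : measurable E -> continuous g ->
  mean g = mass E g + mass (~` E) g.
Proof.
move=> mE cg; rewrite /mean /mass -Rintegral_setU.
- by rewrite -setIUl setUv setTI.
- exact: measurableI.
- by apply: measurableI => //; exact: measurableC.
- by rewrite -setIUl setUv setTI; exact: integrable01.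
- by apply/disj_set2P; rewrite setIACA setICr set0I.
Qed.

(** A continuous function below $g\mathbf 1_E$ reduces a lower bound for the mass on [E] to a mean
    over the whole circle. *)
Lemma mean_le_mass E g v : measurable E -> continuous g -> continuous v ->
  (forall x, E x -> v x <= g x) -> (forall x, x \in `[0, 1[ -> ~ E x -> v x <= 0) ->
  mean v <= mass E g.
Proof.
move=> mE cg cv vg v0; rewrite (mean_mass mE cv) -[leRHS]addr0; apply: lerD.
  apply: le_Rintegral; [exact: measurableI|exact: integrable_mass..|].
  by move=> x [Ex _]; exact: vg.
have mCE := measurableC mE.
have : 0 <= mass (~` E) (fun x => (-1) * v x).
  by apply: Rintegral_ge0 => x [Ex xI]; rewrite mulN1r oppr_ge0; exact: v0.
rewrite /mass RintegralZl; [|exact: measurableI|exact: integrable_mass].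
by rewrite mulN1r oppr_ge0.
Qed.

Lemma mass_le_mean E g v : measurable E -> continuous g -> continuous v ->
  (forall x, E x -> g x <= v x) -> (forall x, 0 <= v x) ->
  mass E g <= mean v.
Proof.
move=> mE cg cv vg v0; rewrite (mean_mass mE cv) -[leLHS]addr0; apply: lerD.
  apply: le_Rintegral; [exact: measurableI|exact: integrable_mass..|].
  by move=> x [Ex _]; exact: vg.
by apply: Rintegral_ge0 => x _; exact: v0.
Qed.

Lemma mean_ge_itv g a b c : continuous g -> (forall x, 0 <= g x) ->
  0 <= a -> a <= b -> b < 1 ->
  (forall x, a <= x <= b -> c <= g x) -> (b - a) * c <= mean g.
Proof.
move=> cg g0 a0 ab b1 H.
have mab : measurable `[a, b]%classic by exact: measurable_itv.
rewrite (mean_mass mab cg) -[leLHS]addr0; apply: lerD; last first.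
  by apply: Rintegral_ge0 => x _; exact: g0.
have -> : (b - a) * c = mass `[a, b] (fun=> c).
  rewrite /mass setIidl; last first.
    by move=> x /=; rewrite !in_itv /= => /andP[ax xb]; rewrite (le_trans a0 ax) (le_lt_trans xb b1).
  rewrite Rintegral_cst //= lebesgue_measure_itv /= lte_fin mulrC.
  by move: ab; rewrite le_eqVlt => /predU1P[->|->]; rewrite ?ltxx ?subrr.
apply: le_Rintegral; [exact: measurableI| |exact: integrable_mass|].
  by apply: integrable_mass => //; exact: cst_continuous.
by move=> x [/= xab _]; apply: H; move: xab; rewrite in_itv.
Qed.

Lemma Lp_mass_amp p E H : measurable E -> continuous (amp p H) ->
  Lp_mass p E (@exp_sum R H) = (mass E (amp p H))%:E.
Proof.
move=> mE cf; rewrite /Lp_mass /mass /Rintegral fineK //.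
apply: integrable_fin_num; first exact: measurableI.
exact: integrable_mass.
Qed.

Lemma concentratesE p c E H : open E -> continuous (amp p H) ->
  concentrates p c E (@exp_sum R H) = (c * mean (amp p H) <= mass E (amp p H)) :> Prop.
Proof.
move=> oE cf; rewrite /concentrates !Lp_mass_amp //; last exact: measurable_realfun.open_measurable.
by rewrite /mass setTI -EFinM lee_fin.
Qed.

Lemma hcos_away_half E : open E -> E 2^-1 ->
  exists2 d : R, 0 < d & forall x, x \in `[0, 1[ -> ~ E x -> d <= hcos x.
Proof.
move=> oE E12; have [r /= r0 rE] := open_nbhs_nbhs (conj oE E12).
(* The cap $1/2$ keeps $2\pi s$ in $[0,\pi]$, where the cosine is decreasing. *)
pose s := Num.min r 2^-1.
have s0 : 0 < s by rewrite lt_min r0 invr_gt0 /=.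
have s2 : s <= 2^-1 by rewrite ge_min lexx orbT.
have pi_0 := @pi_gt0 R.
exists ((1 - cos (2 * pi * s)) / 2).
  rewrite divr_gt0 // subr_gt0 -[ltRHS]cos0 ltr_cos ?mulr_gt0 ?in_itv //=.
    by rewrite lexx ltW.
  by apply/andP; split; nra.
move=> x; rewrite in_itv /= => /andP[x0 x1] Ex.
have hx : hcos x = (1 - cos (2 * pi * `|x - 2^-1|)) / 2.
  have -> : cos (2 * pi * `|x - 2^-1|) = cos (2 * pi * (x - 2^-1)).
    by case: ger0P => // _; rewrite mulrN cosN.
  have := hcosBhalf x; rewrite /hcos; lra.
have xr : r <= `|x - 2^-1|.
  by rewrite leNgt; apply/negP => xr; apply: Ex; apply: rE; rewrite /= distrC.
have sx : s <= `|x - 2^-1| by rewrite ge_min xr.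
have x2 : `|x - 2^-1| <= 2^-1 by rewrite ler_norml; lra.
rewrite hx ler_pM2r ?invr_gt0 // lerD2l lerN2 leNgt ltr_cos ?in_itv /=.
- by rewrite -leNgt ler_pM2l // mulr_gt0.
- by apply/andP; split; nra.
- by apply/andP; split; nra.
Qed.

End Mass.

(** * High powers of a function with a peak at $1/2$ *)

Section PeakRatio.
Context {R : realType}.

(** Laplace's method. Where [hcos] is at most [t], the integrand is at most $tG^L$. Elsewhere $G\le
    g-\eta t$, while $G\ge b=g-\eta t/2$ on an interval of length $2s$ around $1/2$; so that part is
    at most $((g-\eta t)/b)^Lb^L$, negligible for large $L$. *)
Lemma peak_ratio (G : R -> R) (eta k : R) : unif lin1 G -> (forall x, 0 <= G x) ->
  0 < eta -> (forall x, G x + eta * hcos x <= G 2^-1) -> 0 < k ->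
  exists L, 0 < mean (fun x => G x ^+ L) /\
    mean (fun x => hcos x * G x ^+ L) <= k * mean (fun x => G x ^+ L).
Proof.
move=> uG G0 eta0 H k0; set g := G 2^-1.
pose t := Num.min (k / 2) 2^-1.
have t0 : 0 < t by rewrite lt_min divr_gt0 ?invr_gt0 /=.
have tk : t <= k / 2 by rewrite ge_min lexx.
have t2 : t <= 2^-1 by rewrite ge_min lexx orbT.
have geta : eta <= g.
  have := H 0; rewrite /hcos mulr0 cos0; have := G0 0; rewrite -/g; lra.
pose b := g - eta * t / 2.
have b0 : 0 < b by rewrite /b; nra.
have gt_ge0 : 0 <= g - eta * t by nra.
have [r r0 Hr] : exists2 r, 0 < r & forall x, `|2^-1 - x| < r -> b <= G x.
  have /cvgrPdist_le/(_ (eta * t / 2)) := unif1_continuous uG (x := 2^-1).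
  have -> : 0 < eta * t / 2 by rewrite divr_gt0 // mulr_gt0.
  move=> /(_ isT)[r /= r0 rG]; exists r => // x xr.
  by have := rG x xr; rewrite -/g ler_norml /b => /andP[_]; lra.
(* The cap $1/4$ keeps the interval $[1/2-s,1/2+s]$ inside the fundamental domain. *)
pose s := Num.min (r / 2) (4^-1).
have s0 : 0 < s by rewrite lt_min divr_gt0 ?invr_gt0 /=.
have sr : s < r.
  by apply: (@le_lt_trans _ _ (r / 2)); [rewrite ge_min lexx|lra].
have s4 : s <= 4^-1 by rewrite ge_min lexx orbT.
pose rho := (g - eta * t) / b.
have rho0 : 0 <= rho by rewrite divr_ge0 // ltW.
have rho1 : rho < 1 by rewrite ltr_pdivrMr // mul1r /b; nra.
have [L HL] : exists L, rho ^+ L <= t * (2 * s).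
  have e0 : 0 < t * (2 * s) by rewrite !mulr_gt0.
  have /cvg_expr/cvgrPdist_le/(_ _ e0)[L _ /(_ L (leqnn L))] : `|rho| < 1 by rewrite ger0_norm.
  by rewrite sub0r normrN normrX (ger0_norm rho0); exists L.
have uGL : unif lin1 (fun x => G x ^+ L) by exact: (unifX lin1D lin1B lin1_0).
have uh : unif lin1 (@hcos R).
  by apply: (hcos_unif (u := fun x => x) lin1_0); exists 1, 0 => x; rewrite mul1r addr0.
have low : 2 * s * b ^+ L <= mean (fun x => G x ^+ L).
  rewrite (_ : 2 * s = (2^-1 + s) - (2^-1 - s)); last by field.
  apply: mean_ge_itv; rewrite ?subr_ge0; [exact: unif1_continuous| |lra|lra|lra|].
    by move=> x; rewrite exprn_ge0.
  move=> x xs; rewrite lerXn2r ?nnegrE ?(ltW b0) //; apply: Hr.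
  by rewrite ltr_norml; lra.
exists L; split; first by apply: (lt_le_trans _ low); rewrite mulr_gt0 ?exprn_gt0 // mulr_gt0.
have up : mean (fun x => hcos x * G x ^+ L) <= mean (fun x => t * G x ^+ L + (g - eta * t) ^+ L).
  apply: le_mean.
  - exact/unif1_continuous/(unifM lin1D lin1B).
  - apply/unif1_continuous/unifD; last exact: unif_cst lin1_0 _.
    by apply: (unifM lin1D lin1B) => //; exact: unif_cst lin1_0 _.
  move=> x; have GL0 : 0 <= G x ^+ L by rewrite exprn_ge0.
  have /andP[h0 h1] := hcos01 x.
  have [ht|ht] := leP (hcos x) t.
    by rewrite ler_wpDr ?exprn_ge0 // ler_wpM2r.
  rewrite ler_wpDl ?mulr_ge0 ?(ltW t0) //.
  apply: (@le_trans _ _ (G x ^+ L)); first by rewrite ler_piMl.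
  rewrite lerXn2r ?nnegrE //; have := H x; rewrite -/g; nra.
apply: (le_trans up); rewrite meanD ?meanZ ?mean_cst; first last.
- exact: cst_continuous.
- apply/unif1_continuous/(unifM lin1D lin1B) => //; exact: unif_cst lin1_0 _.
- exact: unif1_continuous.
have -> : g - eta * t = rho * b by rewrite /rho divfK // gt_eqF.
rewrite exprMn; have bL : 0 < b ^+ L by rewrite exprn_gt0.
set M := mean _ in low *.
have : rho ^+ L * b ^+ L <= t * M.
  apply: (@le_trans _ _ (t * (2 * s) * b ^+ L)); first by rewrite ler_wpM2r // ltW.
  by rewrite -mulrA ler_wpM2l // ltW.
have M0 : 0 <= M by apply: mean_ge0 => x; rewrite exprn_ge0.
nra.
Qed.

End PeakRatio.

(** * Full concentration with gap *)

Section NonEven.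
Context {R : realType}.

Lemma concentration_half_not_even (p : R) : 0 < p -> ~ (exists k : nat, p = (2 * k)%:R) ->
  forall c : R, c < 1 -> forall E : set R, sym_open_nbhd 2^-1 E -> forall N : nat,
  exists2 f, gap_idempotents N f & concentrates p c E f.
Proof.
move=> p0 pN c c1 E [_ oE _ E12] N.
pose q := (Num.truncn (p / 2)).+1.
have pq : p / 2 < q%:R by rewrite truncnS_gt.
have {}pN m : p / 2 != m%:R.
  by apply/eqP => pm; apply: pN; exists m; rewrite natrM -pm; field.
have [d d0 dE] := hcos_away_half oE E12.
have [eta eta0 Heta] := profile_gap p0 pN pq.
have uP := profile_unif q p0 pN.
pose s := d * (1 - c); have s0 : 0 < s by rewrite mulr_gt0 // subr_gt0.
have s40 : 0 < s / 4 by rewrite divr_gt0.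
have [L [M0 HM]] := peak_ratio uP (@profile_ge0 _ p q) eta0 Heta s40.
set M := mean _ in M0 HM.
(* With this error $A\ge\frac34M$ and $B\le\frac s4M+e\le\frac s2M$, whence $B\le sA$. *)
pose e := M * Num.min (s / 4) 4^-1.
have e0 : 0 < e by rewrite mulr_gt0 // lt_min s40 invr_gt0 /=.
have es : e <= M * (s / 4) by rewrite ler_pM2l // ge_min lexx.
have e4 : e <= M * 4^-1 by rewrite ler_pM2l // ge_min lexx orbT.
have uh : unif lin1 (@hcos R).
  by apply: (hcos_unif (u := fun x => x) lin1_0); exists 1, 0 => x; rewrite mul1r addr0.
have [H [H0 sH uH HE]] := riesz_products p0 pN pq L N (unif_cst lin1_0 1) uh e0.
exists (exp_sum H); first by exists H => //; split => //; exact: sparse_gaps.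
have cH := unif1_continuous uH.
rewrite concentratesE //.
have := HE _ (or_introl erefl); have := HE _ (or_intror erefl).
rewrite (_ : (fun x => 1 * amp p H x) = amp p H); last by apply/funext => x; rewrite mul1r.
rewrite (_ : (fun x => 1 * profile p q x ^+ L) = fun x => profile p q x ^+ L); last first.
  by apply/funext => x; rewrite mul1r.
rewrite -/M !ler_norml => /andP[_ h2] /andP[h1 _].
set A := mean (amp p H) in h1 *; set B := mean _ in h2.
(* This is $|f|^p(1-$[hcos]$/d)$: at most $|f|^p$ everywhere and nonpositive off [E], where [hcos]
   is at least [d]. Its mean $A-B/d$ is at least $cA$, because $B\le d(1-c)A$. *)
pose v x := amp p H x + (- d^-1) * (hcos x * amp p H x).
have uhA : unif lin1 (fun x => hcos x * amp p H x) by exact: (unifM lin1D lin1B).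
have uv : unif lin1 v.
  by apply: unifD => //; apply: (unifM lin1D lin1B) => //; exact: unif_cst lin1_0 _.
have mv : mean v = A - d^-1 * B.
  rewrite /v meanD ?meanZ ?mulNr //; first exact: unif1_continuous.
  by apply/unif1_continuous/(unifM lin1D lin1B) => //; exact: unif_cst lin1_0 _.
have Bs : B <= s * A by nra.
apply: (@le_trans _ _ (mean v)).
  have : d^-1 * B <= (1 - c) * A by rewrite ler_pdivrMl // mulrA.
  by rewrite mv; lra.
apply: mean_le_mass => //; [exact: measurable_realfun.open_measurable|exact: unif1_continuous| |].
- move=> x _; rewrite /v mulNr gerBl mulr_ge0 ?invr_ge0 ?(ltW d0) //.
  by case/andP: (hcos01 x) => h0 _; rewrite mulr_ge0 // powR_ge0.
- move=> x xI xE; rewrite /v mulNr mulrA subr_le0 ler_peMl ?powR_ge0 //.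
  by rewrite mulrC ler_pdivlMr // mul1r; exact: dE.
Qed.

End NonEven.

(** * Even exponents *)

Section EvenExponent.
Context {R : realType}.
Implicit Types (H : {fset nat}) (x t c : R) (k j : nat).

Local Notation normc := ComplexField.Normc.normc.

(** Pure cosines without phase shift, so that [P] constrains the coefficients and frequencies of an
    even function. *)
Definition freq (P : R -> int -> Prop) (c : R) (u : R -> R) :=
  exists2 n : int, P c n & forall x, u x = n%:~R * x.

Lemma freqM (P P' Q : R -> int -> Prop) F G :
  (forall c n c' n', P c n -> P' c' n' -> Q (c * c' / 2) (n + n') /\ Q (c * c' / 2) (n - n')) ->
  cosum (freq P) F -> cosum (freq P') G -> cosum (freq Q) (fun x => F x * G x).
Proof.
move=> PQ; apply: cosumM => c u c' u' [n Pn un] [n' Pn' un'].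
have [Q1 Q2] := PQ _ _ _ _ Pn Pn'.
by split; [exists (n + n')|exists (n - n')] => // x; rewrite un un' ?rmorphD ?rmorphB /=; ring.
Qed.

Lemma freqX (P : R -> int -> Prop) F k :
  (forall c n c' n', P c n -> P c' n' -> P (c * c' / 2) (n + n') /\ P (c * c' / 2) (n - n')) ->
  P 1 0 -> cosum (freq P) F -> cosum (freq P) (fun x => F x ^+ k).
Proof.
move=> PM P1 cF; elim: k => [|k IH].
  apply: cosum_ext (@cosum1 _ _ (freq P) 1 (fun x => 0%:~R * x) _) => [x|].
    by rewrite mul0r mulr0 cos0 mul1r expr0.
  by exists 0.
by apply: cosum_ext (freqM PM cF IH) => x; rewrite exprS.
Qed.

Lemma freq_lin1 P F : cosum (freq P) F -> trig lin1 F.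
Proof. by apply: cosum_sub => c u [n _ un]; exists n, 0 => x; rewrite addr0. Qed.

Lemma mean_freq_cons c (n : int) F : trig lin1 F ->
  mean (fun x => c * cos (2 * pi * (n%:~R * x)) + F x) = (n == 0)%:R * c + mean F.
Proof.
move=> tF.
have E : (fun x => cos (2 * pi * (n%:~R * x))) = fun x => cos (2 * pi * (n%:~R * x + 0)).
  by apply/funext => x; rewrite addr0.
have cc := @continuous_cos_affine R n%:~R 0; rewrite -E in cc.
rewrite meanD ?meanZ //.
- by rewrite E mean_cos mulr0 cos0 mulr1 mulrC.
- by move=> x; apply: cvgM; [exact: cvg_cst|exact: cc].
- exact: trig1_continuous.
Qed.

Lemma mean_pos_freq F : cosum (freq (fun c _ => 0 <= c)) F -> 0 <= mean F.
Proof.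
elim=> [|c u G [n c0 /funext ->] cG IH]; first by rewrite mean_cst.
rewrite mean_freq_cons; last exact: freq_lin1 cG.
by rewrite addr_ge0 ?mulr_ge0.
Qed.

Lemma mean_nonzero_freq F : cosum (freq (fun _ n => n != 0)) F -> mean F = 0.
Proof.
elim=> [|c u G [n n0 /funext ->] cG IH]; first by rewrite mean_cst.
rewrite mean_freq_cons; last exact: freq_lin1 cG.
by rewrite (negPf n0) mul0r add0r.
Qed.

Definition sqamp H x : R := \sum_(h <- H) \sum_(h' <- H) cos (2 * pi * ((h%:Z - h'%:Z)%:~R * x)).

Lemma sum_Complex (I : Type) (r : seq I) (f g : I -> R) :
  \sum_(i <- r) (Complex (f i) (g i)) = Complex (\sum_(i <- r) f i) (\sum_(i <- r) g i).
Proof.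
elim: r => [|i r IH]; first by rewrite !big_nil.
by rewrite !big_cons IH.
Qed.

Lemma sqampE H x : normc (exp_sum H x) ^+ 2 = sqamp H x.
Proof.
rewrite normc_sqr /exp_sum sum_Complex /= !expr2 /sqamp !big_distrlr /= -big_split /=.
apply: eq_bigr => h _; rewrite -big_split /=; apply: eq_bigr => h' _.
by rewrite -cosB rmorphB /= -mulrBr mulrBl.
Qed.

Lemma sqamp_ge0 H x : 0 <= sqamp H x.
Proof. by rewrite -sqampE sqr_ge0. Qed.

Lemma amp_even H k : amp (2 * k)%:R H = fun x => sqamp H x ^+ k.
Proof. by apply/funext => x; rewrite /amp powR_mulrn ?normc_ge0 // exprM sqampE. Qed.

Lemma sqamp_freq (P : R -> int -> Prop) H :
  (forall h h', h \in H -> h' \in H -> P 1 (h%:Z - h'%:Z)) -> cosum (freq P) (sqamp H).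
Proof.
move=> HP.
apply: (@cosum_ext _ _ _ (fun x => \sum_(h <- enum_fset H | h \in H) \sum_(h' <- enum_fset H | h' \in H)
   cos (2 * pi * ((h%:Z - h'%:Z)%:~R * x)))).
  by move=> x; rewrite /sqamp -big_seq; apply: eq_bigr => h _; rewrite -big_seq.
apply: (@cosum_ext _ _ _ (fun x => \sum_(h <- enum_fset H) \sum_(h' <- enum_fset H)
   (if (h \in H) && (h' \in H) then cos (2 * pi * ((h%:Z - h'%:Z)%:~R * x)) else 0))).
  move=> x; rewrite [RHS]big_mkcond; apply: eq_bigr => h _; rewrite [in RHS]big_mkcond.
  by case: (h \in H) => //=; rewrite big1.
apply: cosum_sum => h; apply: cosum_sum => h'.
case: (boolP ((h \in H) && (h' \in H))) => [/andP[hH h'H]|_]; last exact: cosum0.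
apply: cosum_ext (@cosum1 _ _ (freq P) 1 (fun x => (h%:Z - h'%:Z)%:~R * x) _) => [x|].
  by rewrite mul1r.
by exists (h%:Z - h'%:Z) => //; exact: HP.
Qed.

Lemma mean_sum I (r : seq I) (F : I -> R -> R) : (forall i, trig lin1 (F i)) ->
  mean (fun x => \sum_(i <- r) F i x) = \sum_(i <- r) mean (F i).
Proof.
move=> tF; elim: r => [|i r IH].
  by rewrite big_nil -[RHS]mean_cst; congr mean; apply/funext => x; rewrite big_nil.
rewrite big_cons -IH -meanD; [|exact: trig1_continuous|].
  by congr mean; apply/funext => x; rewrite big_cons.
by apply: trig1_continuous; exact: cosum_sum.
Qed.

(** Each diagonal pair contributes 1 and the other pairs contribute nonnegative means. *)
Lemma mean_sqamp H : (size (enum_fset H))%:R <= mean (sqamp H).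
Proof.
have tc (n : int) : trig lin1 (fun x => cos (2 * pi * (n%:~R * x))).
  apply: cosum_ext (@cosum1 _ _ (fun=> lin1) 1 (fun x => n%:~R * x) _) => [x|].
    by rewrite mul1r.
  by exists n, 0 => x; rewrite addr0.
have mc (n : int) : mean (fun x => cos (2 * pi * (n%:~R * x))) = (n == 0)%:R.
  rewrite -[RHS]mulr1 -[RHS]addr0 -(mean_cst 0) -mean_freq_cons.
    by congr mean; apply/funext => x; rewrite mul1r addr0.
  exact: trig_cst lin1_0 _.
rewrite /sqamp mean_sum; last first.
  move=> h; apply: (cosum_sum _
    (F := fun h' : nat => fun x => cos (2 * pi * ((h%:Z - h'%:Z)%:~R * x)))) => h'.
  exact: tc.
rewrite -sum1_size natr_sum !big_seq; apply: ler_sum => h hH.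
rewrite mean_sum; last by move=> h'; exact: tc.
rewrite (bigD1_seq h) ?fset_uniq //= mc subrr eqxx lerDl.
by apply: sumr_ge0 => h' _; rewrite mc.
Qed.

Lemma bernoulli_ineq (t : R) k : 0 <= t -> 1 + k%:R * (t - 1) <= t ^+ k.
Proof.
move=> t0; elim: k => [|k IH]; first by rewrite mul0r addr0 expr0.
rewrite exprS -natr1; apply: le_trans (ler_wpM2l t0 IH).
have := sqr_ge0 (t - 1); have : 0 <= k%:R :> R by [].
by nra.
Qed.

Lemma sqamp_lin1 H : trig lin1 (sqamp H).
Proof. exact/(@freq_lin1 (fun _ _ => True))/sqamp_freq. Qed.

Lemma sqampX_lin1 H k : trig lin1 (fun x => sqamp H x ^+ k).
Proof.
apply: (@freq_lin1 (fun _ _ => True)); apply: freqX => //.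
exact: sqamp_freq.
Qed.

(** Bernoulli's inequality integrates to $\int|f|^{2k}\ge1-k+km$ with $m=\int|f|^2\ge1$, and the
    right side is at least $m$. The total mass thus grows with the spectrum. *)
Lemma mean_sqampX H k : (0 < k)%N -> H != fset0 ->
  (size (enum_fset H))%:R <= mean (fun x => sqamp H x ^+ k).
Proof.
move=> k0 H0; apply: le_trans (mean_sqamp H) _.
set m := mean (sqamp H).
have m1 : 1 <= m.
  apply: le_trans (mean_sqamp H); rewrite ler1n.
  by case/fset0Pn: H0 => h; rewrite -[h \in H]/(h \in enum_fset H); case: (enum_fset H).
have : mean (fun x => (1 - k%:R) + k%:R * sqamp H x) <= mean (fun x => sqamp H x ^+ k).
  apply: le_mean.
  - move=> x; apply: cvgD; first exact: cvg_cst.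
    by apply: cvgM; [exact: cvg_cst|exact: (trig1_continuous (sqamp_lin1 H))].
  - exact/trig1_continuous/sqampX_lin1.
  move=> x; apply: le_trans (bernoulli_ineq k (sqamp_ge0 H x)).
  by rewrite mulrBr mulr1; lra.
rewrite meanD ?mean_cst ?meanZ -/m; first last.
- move=> x; apply: cvgM; [exact: cvg_cst|exact: (trig1_continuous (sqamp_lin1 H))].
- exact: cst_continuous.
- exact/trig1_continuous/sqamp_lin1.
apply: le_trans; have : 1 <= k%:R :> R by rewrite ler1n.
nra.
Qed.

(** The obstruction at even exponents: $|f|^{2k}$ is a sum of cosines with nonnegative coefficients,
    and so is its product with $\cos(2\pi x)$. *)
Lemma mean_cos_sqampX_ge0 H k : 0 <= mean (fun x => cos (2 * pi * x) * sqamp H x ^+ k).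
Proof.
apply: mean_pos_freq; pose P (c : R) (n : int) := 0 <= c.
have PM c n c' n' : P c n -> P c' n' -> P (c * c' / 2) (n + n') /\ P (c * c' / 2) (n - n').
  by move=> c0 c'0; rewrite /P; split; rewrite divr_ge0 // mulr_ge0.
apply: (freqM PM); last by apply: freqX => //; [exact: ler01|apply: sqamp_freq => *; exact: ler01].
apply: cosum_ext (@cosum1 _ _ (freq P) 1 (fun x => 1%:~R * x) _) => [x|].
  by rewrite !mul1r.
by exists 1 => //; exact: ler01.
Qed.

(** An even spectrum gives $|f|^{2k}$ only even frequencies, which are orthogonal to frequency 1. *)
Lemma mean_cos_even_spectrum H k : (forall h, h \in H -> ~~ odd h) ->
  mean (fun x => cos (2 * pi * x) * sqamp H x ^+ k) = 0.
Proof.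
move=> Hev; apply: mean_nonzero_freq; pose P (c : R) (n : int) := exists m, n = 2 * m.
have PM c n c' n' : P c n -> P c' n' -> P (c * c' / 2) (n + n') /\ P (c * c' / 2) (n - n').
  by move=> [m ->] [m' ->]; split; [exists (m + m')|exists (m - m')]; ring.
have cS : cosum (freq P) (fun x => sqamp H x ^+ k).
  apply: freqX => //; first by exists 0.
  apply: sqamp_freq => h h' /Hev hev /Hev h'ev; exists ((h./2)%:Z - (h'./2)%:Z).
  by have := odd_double_half h; have := odd_double_half h'; lia.
have c1 : cosum (freq (fun _ n => n = 1)) (fun x => cos (2 * pi * x)).
  apply: cosum_ext (@cosum1 _ _ (freq (fun _ n => n = 1)) 1 (fun x => 1%:~R * x) _) => [x|].
    by rewrite !mul1r.
  by exists 1.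
by apply: freqM c1 cS => c n c' n' -> [m ->]; split; lia.
Qed.

(** On [E] one has $1-\cos(2\pi x)>2-2\tau$, so the mass there is at most $\int(1-\cos2\pi
    x)|f|^{2k}/(2-2\tau)$, and the cosine term can only lower this integral. *)
Lemma half_upper_bound H k c tau : (0 < k)%N -> H != fset0 -> 0 < tau < 1 ->
  let E := [set x : R | cos (2 * pi * x) < - 1 + 2 * tau] in
  concentrates (2 * k)%:R c E (exp_sum H) -> c * (2 - 2 * tau) <= 1.
Proof.
move=> k0 H0 /andP[t0 t1] E.
have cosc : continuous (fun x : R => cos (2 * pi * x)).
  by have := @continuous_cos_affine R 1 0; under eq_fun do rewrite mul1r addr0.
have oE : open E.
  by apply: (open_comp (f := fun x => cos (2 * pi * x))) (@open_lt _ _) => x _; exact: cosc.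
have cg := trig1_continuous (sqampX_lin1 H k).
rewrite concentratesE //; last by rewrite amp_even.
rewrite amp_even.
set T := mean _ => cT.
have T0 : 0 < T.
  apply: (lt_le_trans _ (mean_sqampX k0 H0)); rewrite ltr0n.
  by case/fset0Pn: H0 => h; rewrite -[h \in H]/(h \in enum_fset H); case: (enum_fset H).
have ccg : continuous (fun x => cos (2 * pi * x) * sqamp H x ^+ k).
  by move=> x; apply: cvgM; [exact: cosc|exact: cg].
pose v x := (2 - 2 * tau)^-1 * (sqamp H x ^+ k - cos (2 * pi * x) * sqamp H x ^+ k).
have cB : continuous (fun x => sqamp H x ^+ k - cos (2 * pi * x) * sqamp H x ^+ k).
  by move=> x; apply: cvgB; [exact: cg|exact: ccg].
have tt : 0 < 2 - 2 * tau by lra.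
have : mass E (fun x => sqamp H x ^+ k) <= mean v.
  apply: mass_le_mean => //.
  - exact: measurable_realfun.open_measurable.
  - by move=> x; apply: cvgM; [exact: cvg_cst|exact: cB].
  - move=> x; rewrite /E /= /v => Ex; rewrite ler_pdivlMl //.
    have : 0 <= sqamp H x ^+ k by rewrite exprn_ge0 // sqamp_ge0.
    by nra.
  - move=> x; rewrite /v mulr_ge0 ?invr_ge0 ?(ltW tt) // subr_ge0 ler_piMl ?cos_le1 //.
    by rewrite exprn_ge0 // sqamp_ge0.
rewrite /v meanZ // meanB // -/T; have := mean_cos_sqampX_ge0 H k.
set D := mean _ => D0 mE; have := le_trans cT mE.
rewrite ler_pdivlMl // => H1.
have : (c * (2 - 2 * tau)) * T <= 1 * T by lra.
by rewrite ler_pM2r.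
Qed.

(** The even numbers below $2^{j+1}$, built as the spectrum of $\prod_{i=1}^{j}(1+e(2^ix))$. *)
Fixpoint dyadic j : {fset nat} :=
  if j is j'.+1 then shift_union (dyadic j') (2 ^ j'.+1) else [fset 0%N]%fset.

Lemma dyadic_lt j h : h \in dyadic j -> (h < 2 ^ j.+1)%N.
Proof.
elim: j h => [|j IH] h /=; first by rewrite inE => /eqP ->.
rewrite mem_shift_union => /orP[/IH|/andP[jh /IH]]; rewrite [(2 ^ j.+2)%N]expnS; lia.
Qed.

Lemma dyadic_even j h : h \in dyadic j -> ~~ odd h.
Proof.
elim: j h => [|j IH] h /=; first by rewrite inE => /eqP ->.
rewrite mem_shift_union => /orP[/IH //|/andP[jh /IH]].
by rewrite oddB // oddX /= addbF.
Qed.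

Lemma dyadic_neq0 j : dyadic j != fset0.
Proof.
elim: j => [|j IH] /=; last exact: shift_union_neq0.
by apply/fset0Pn; exists 0%N; rewrite inE.
Qed.

Lemma dyadic_size j : size (enum_fset (dyadic j)) = (2 ^ j)%N.
Proof.
elim: j => [|j IH]; first by rewrite /= -[LHS]/(#|` [fset 0%N]%fset|) cardfs1.
rewrite /= (perm_size (shift_union_perm (@dyadic_lt j))).
by rewrite size_cat size_map IH expnS; lia.
Qed.

Lemma exp_sum_dyadic j x :
  (1 - e2pi (2 * x)) * exp_sum (dyadic j) x = 1 - e2pi ((2 ^ j.+1)%:R * x).
Proof.
elim: j => [|j IH].
  by rewrite /exp_sum /= big_seq_fset1 mul0r /e2pi mulr0 cos0 sin0 mulr1.
rewrite /= exp_sum_shift_union; last exact: dyadic_lt.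
rewrite mulrA IH mulrDr mulr1 mulrBl mul1r -e2piD -mulrDl -natrD.
rewrite addrA subrK addnn -mul2n -expnS.
by [].
Qed.

Lemma normc1Be2pi t : normc (1 - e2pi t) ^+ 2 = 4 * (1 - hcos t).
Proof.
rewrite normc_sqr /e2pi /= /hcos sub0r sqrrN.
have := cos2Dsin2 (2 * pi * t).
set c := cos _; set s := sin _ => E.
rewrite (_ : (1 - c) ^+ 2 + s ^+ 2 = 1 - 2 * c + (c ^+ 2 + s ^+ 2)); last by ring.
by rewrite E; field.
Qed.

(** The Fejér kernel bound: the factor in front is $\sin^2(2\pi x)$, so $|f|^2$ is bounded uniformly
    in [j] away from 0 and $1/2$. *)
Lemma sqamp_dyadic_le j x : 4 * hcos x * (1 - hcos x) * sqamp (dyadic j) x <= 1.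
Proof.
have := congr1 (fun z => normc z ^+ 2) (exp_sum_dyadic j x).
rewrite ComplexField.Normc.normcM exprMn sqampE !normc1Be2pi.
have -> : 1 - hcos (2 * x) = 4 * hcos x * (1 - hcos x).
  rewrite /hcos (_ : 2 * pi * (2 * x) = (2 * pi * x) *+ 2); last by rewrite -mulr_natr; ring.
  by rewrite cos_mulr2n -mulr_natr; field.
rewrite -[LHS]mulrA; set X := 4 * hcos x * (1 - hcos x) * sqamp _ _.
by have /andP[] := hcos01 ((2 ^ j.+1)%:R * x); lra.
Qed.

Lemma half_lower_bound k c (E : set R) : (0 < k)%N -> c < 2^-1 -> open E -> E 2^-1 ->
  exists2 H, H != fset0 & concentrates (2 * k)%:R c E (@exp_sum R H).
Proof.
move=> k0 c2 oE E12; have [d d0 dE] := hcos_away_half oE E12.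
pose tau := Num.min ((2^-1 - c) / 2) 1.
have t0 : 0 < tau by rewrite lt_min ltr01 andbT; lra.
have tc : tau <= (2^-1 - c) / 2 by rewrite ge_min lexx.
have t1 : tau <= 1 by rewrite ge_min lexx orbT.
(* Bounds $|f|^{2k}$ wherever [hcos] is at least [d] and [1 - hcos] exceeds [tau]. The choice of [j]
   below makes $2^j\ge C/\tau$, hence [C] at most $\tau T$. *)
pose C := (4 * d * tau)^-1 ^+ k.
have td : 0 < 4 * d * tau by rewrite !mulr_gt0.
have C0 : 0 < C by rewrite exprn_gt0 // invr_gt0.
pose j := (Num.truncn (C / tau)).+1; pose H := dyadic j.
exists H; first exact: dyadic_neq0.
have cS : continuous (sqamp H) by exact/trig1_continuous/sqamp_lin1.
have cg : continuous (fun x => sqamp H x ^+ k) by exact/trig1_continuous/sqampX_lin1.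
have cosc : continuous (fun x : R => cos (2 * pi * x)).
  by have := @continuous_cos_affine R 1 0; under eq_fun do rewrite mul1r addr0.
rewrite concentratesE //; last by rewrite amp_even.
rewrite amp_even; set T := mean _.
have TC : C <= tau * T.
  rewrite -ler_pdivrMl // mulrC.
  apply: le_trans (mean_sqampX k0 (dyadic_neq0 j)); rewrite dyadic_size.
  have /ltW := @truncnS_gt _ (C / tau); move/le_trans; apply.
  by rewrite ler_nat ltnW // ltn_expl.
(* This is $(1-$[hcos]$-\tau)|f|^{2k}-C$. Off [E] it is nonpositive, near 0 by the first factor and
   elsewhere by [C]. The cosine term has mean zero, so its mean is $(1/2-\tau)T-C\ge(1/2-2\tau)T\ge
   cT$. *)
pose v x := ((2^-1 - tau) * sqamp H x ^+ k + (- 2^-1) * (cos (2 * pi * x) * sqamp H x ^+ k)) - C.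
have c1 : continuous (fun x => (2^-1 - tau) * sqamp H x ^+ k).
  by move=> x; apply: cvgM; [exact: cvg_cst|exact: cg].
have c2' : continuous (fun x => cos (2 * pi * x) * sqamp H x ^+ k).
  by move=> x; apply: cvgM; [exact: cosc|exact: cg].
have c3 : continuous (fun x => (- 2^-1) * (cos (2 * pi * x) * sqamp H x ^+ k)).
  by move=> x; apply: cvgM; [exact: cvg_cst|exact: c2'].
have c4 : continuous (fun x => (2^-1 - tau) * sqamp H x ^+ k
    + (- 2^-1) * (cos (2 * pi * x) * sqamp H x ^+ k)).
  by move=> x; apply: cvgD; [exact: c1|exact: c3].
have cv : continuous v.
  by move=> x; apply: cvgB; [exact: c4|exact: cvg_cst].
apply: (@le_trans _ _ (mean v)).
  rewrite /v meanB //; last exact: cst_continuous.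
  rewrite meanD // !meanZ // mean_cst mean_cos_even_spectrum; last exact: dyadic_even.
  rewrite mulr0 addr0 -/T.
  have T0 : 0 <= T by apply: mean_ge0 => x; rewrite exprn_ge0 // sqamp_ge0.
  nra.
apply: mean_le_mass => //; first exact: measurable_realfun.open_measurable.
  move=> x _; have g0 : 0 <= sqamp H x ^+ k by rewrite exprn_ge0 // sqamp_ge0.
  by rewrite /v; have := cos_geN1 (2 * pi * x); nra.
move=> x xI xE; have g0 : 0 <= sqamp H x ^+ k by rewrite exprn_ge0 // sqamp_ge0.
have vE : v x = (1 - hcos x - tau) * sqamp H x ^+ k - C by rewrite /v /hcos; field.
have /andP[h0 h1] := hcos01 x.
have [kt|kt] := leP (1 - hcos x) tau.
  by rewrite vE; nra.
have gC : sqamp H x ^+ k <= C.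
  rewrite lerXn2r ?nnegrE ?sqamp_ge0 ?invr_ge0 ?(ltW td) //.
  rewrite -[leRHS]mulr1 ler_pdivlMl //; apply: le_trans (sqamp_dyadic_le j x).
  apply: ler_wpM2r; first exact: sqamp_ge0.
  have := dE x xI xE => dh; apply: ler_pM; rewrite ?mulr_ge0 ?(ltW d0) ?(ltW t0) ?(ltW kt) //.
  by rewrite ler_pM2l.
by rewrite vE; nra.
Qed.

Lemma concentration_const_even k : (0 < k)%N ->
  concentration_const (2 * k)%:R (2^-1 : R) = (2^-1)%:E.
Proof.
move=> k0; apply/eqP; rewrite eq_le; apply/andP; split.
  apply: ub_ereal_sup => _ [c [c0 Hc] <-]; rewrite lee_fin leNgt; apply/negP => c2.
  (* With this value $c(2-2\tau)=c+1/2>1$, contradicting [half_upper_bound]. *)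
  pose tau := (2 * c - 1) / (4 * c).
  have c4 : 0 < 4 * c by lra.
  have tauE : tau * (4 * c) = 2 * c - 1 by rewrite /tau divfK // gt_eqF.
  have t01 : 0 < tau < 1.
    by rewrite /tau ltr_pdivrMr // divr_gt0 //; lra.
  pose E := [set x : R | cos (2 * pi * x) < - 1 + 2 * tau].
  have nE : sym_open_nbhd 2^-1 E.
    split.
    - by move=> x; rewrite /E /= mulrDr (cosDn2pi 1); split.
    - apply: (open_comp (f := fun x => cos (2 * pi * x))) (@open_lt _ _) => x _.
      by have := @continuous_cos_affine R 1 0 x; under eq_fun do rewrite mul1r addr0.
    - by move=> x; rewrite /E /= mulrN cosN.
    - by rewrite /E /= mulrAC divff // mul1r cospi; lra.
  have [_ [H /= H0 <-] HE] := Hc E nE.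
  have := half_upper_bound k0 H0 t01 HE; nra.
apply/lee_addgt0Pr => e e0; pose c := Num.max 0 (2^-1 - e).
have ce : 2^-1 <= c + e by rewrite -lerBlDr le_max lexx orbT.
apply: (@le_trans _ _ (c + e)%:E); first by rewrite lee_fin.
rewrite EFinD leeD2r //; apply: ereal_sup_ubound; exists c => //; split.
  by rewrite le_max lexx.
move=> E [_ oE _ E12].
have c2 : c < 2^-1 by rewrite gt_max invr_gt0 /= gtrBl e0 andbT.
have [H H0 HE] := half_lower_bound k0 c2 oE E12.
by exists (exp_sum H) => //; exists H.
Qed.

End EvenExponent.

Theorem proposition10 (R : realType) (p : R) (hp : 0 < p) :
  ((~ exists k : nat, p = (2 * k)%:R) ->
     forall (c : R), c < 1 ->
     forall (E : set R), sym_open_nbhd (2^-1) E ->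
     forall (N : nat), (0 < N)%N ->
     exists2 f, gap_idempotents N f & concentrates p c E f)
  /\
  (forall k : nat, (1 <= k)%N -> p = (2 * k)%:R ->
     concentration_const p 2^-1 = (2^-1)%:E).
Proof.
split=> [pN c c1 E nE N _|k k1 ->]; first exact: concentration_half_not_even.
exact: concentration_const_even.
Qed.
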